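(* Let $\mathbbm{k}$ be a field and let $S$ be a unimodular Frobenius Poisson algebra over $\mathbbm{k}$, with associated operator $\Delta:\mathfrak{X}^\bullet(S)\to\mathfrak{X}^{\bullet-1}(S)$. Then $\Delta$ induces an operator on Poisson cohomology $\mathrm{HP}^\bullet(S)$ whose square is zero. Furthermore, for $\alpha\in\mathrm{HP}^m(S)$ and $\beta\in\mathrm{HP}^n(S)$, $$[\alpha,\beta]_S=-(-1)^{(m-1)n}\big(\Delta(\alpha\wedge\beta)-\Delta(\alpha)\wedge\beta-(-1)^m\alpha\wedge\Delta(\beta)\big),$$ where $\wedge$ and $[\,,\,]_S$ on $\mathrm{HP}(S)=\bigoplus_k \mathrm{HP}^k(S)$ are induced by the wedge product and the Schouten bracket. Equivalently, the Poisson cohomology ring $\mathrm{HP}(S)$ has a Batalin-Vilkovisky algebra structure (with operator $\Delta$).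
   Context: A Poisson algebra is a commutative $\mathbbm{k}$-algebra $S$ with a bilinear Lie bracket $\{-,-\}: S\otimes S\to S$ that is a derivation in each variable. It is a Frobenius Poisson algebra if $S$ is Frobenius as an associative algebra: there is an isomorphism of $S$-modules $\sigma:S\to S^*$ ($\mathbbm{k}$-linear dual); the associated non-degenerate bilinear form is $\langle a,b\rangle:=\sigma(b)(a)$, satisfying $\langle ab,c\rangle=\langle a,bc\rangle$. $\mathfrak{X}^k(S)$ is the space of all $\mathbbm{k}$-linear maps $S^{\otimes k}\to S$ that are derivations in each argument and skew-symmetric, i.e. $f(a_1,\dots,a_k)=\varepsilon(\theta)f(a_{\theta_1},\dots,a_{\theta_k})$ for all permutations $\theta$ ($\varepsilon$ = sign, $\theta_i=\theta(i)$); $\mathfrak{X}^0(S)=S$; $\mathfrak{X}(S)=\bigoplus_k\mathfrak{X}^k(S)$. $S_{m,n}$ is the set of permutations of $\{1,\dots,m+n\}$ with $\theta_1<\dots<\theta_m$ and $\theta_{m+1}<\dots<\theta_{m+n}$. For $P\in\mathfrak{X}^m(S)$, $Q\in\mathfrak{X}^n(S)$: $$(P\wedge Q)(a_1,\dots,a_{m+n})=\sum_{\theta\in S_{m,n}}\varepsilon(\theta)P(a_{\theta_1},\dots,a_{\theta_m})Q(a_{\theta_{m+1}},\dots,a_{\theta_{m+n}}),$$ $$(P\circ Q)(a_1,\dots,a_{m+n-1})=\sum_{\theta\in S_{n,m-1}}\varepsilon(\theta)P(Q(a_{\theta_1},\dots,a_{\theta_n}),a_{\theta_{n+1}},\dots,a_{\theta_{m+n-1}})$$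 (with $P\circ Q=0$ if $m=0$), and the Schouten bracket is $[P,Q]_S=P\circ Q-(-1)^{(m-1)(n-1)}Q\circ P$. Poisson cohomology $\mathrm{HP}^\bullet(S)$ is the cohomology of $(\mathfrak{X}^\bullet(S),\delta_\bullet)$ with $$\delta_k(P)(y_0,\dots,y_k)=\sum_{0\le i\le k}(-1)^i\{y_i,P(y_0,\dots,\widehat{y_i},\dots,y_k)\}+\sum_{0\le i<j\le k}(-1)^{i+j}P(\{y_i,y_j\},y_0,\dots,\widehat{y_i},\dots,\widehat{y_j},\dots,y_k).$$ It is known that $\wedge$ and $[\,,\,]_S$ make $\mathfrak{X}(S)$ a Gerstenhaber algebra and induce such a structure on $\mathrm{HP}(S)$. The operator $\Delta$: for $P\in\mathfrak{X}^m(S)$, $m\ge1$, $\Delta(P)\in\mathfrak{X}^{m-1}(S)$ is determined by $\langle\Delta(P)(a_1,\dots,a_{m-1}),a_m\rangle=(-1)^{m-1}\langle P(a_1,\dots,a_m),1\rangle$ for all $a_i\in S$; $\Delta=0$ on $\mathfrak{X}^0(S)$. Let $\pi\in\mathfrak{X}^2(S)$, $\pi(a,b)=\{a,b\}$. $S$ (with its form and $\Delta$) is unimodular if $\Delta(\pi)=0$. A Gerstenhaber algebra $(A^\bullet,\wedge,[\,,\,])$ is a $\mathbb{Z}$-graded commutative algebra $(A,\wedge)$ with a bracket of degree $-1$ that makes $A^{\bullet+1}$ a graded Lie algebra (graded antisymmetry $[a,b]=-(-1)^{(m-1)(n-1)}[b,a]$ and graded Jacobi) and satisfies $[a\wedge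 b,c]=[a,c]\wedge b+(-1)^{m(p-1)}a\wedge[b,c]$ for $a\in A^m$, $b\in A^n$, $c\in A^p$. A Batalin-Vilkovisky algebra is a triple $(A^\bullet,\wedge,\Delta)$ with $(A,\wedge)$ a $\mathbb{Z}$-graded commutative algebra and $\Delta:A\to A$ of degree $-1$ with $\Delta^2=0$, such that the bracket defined for $a\in A^m$, $b\in A^n$ by $-(-1)^{(m-1)n}[a,b]:=\Delta(a\wedge b)-\Delta(a)\wedge b-(-1)^m a\wedge\Delta(b)+(-1)^m a\wedge\Delta(1)\wedge b$ makes $(A^\bullet,\wedge,[\,,\,])$ a Gerstenhaber algebra. *)

(* Defs.v *)
From HB Require Import structures.
From mathcomp Require Import all_boot perm all_algebra.
From mathcomp Require Import mathcomp_extra boolp classical_sets functions.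

Set Implicit Arguments.
Unset Strict Implicit.
Unset Printing Implicit Defensive.

Import GRing.Theory.
Local Open Scope ring_scope.

Record poissonBracket (k : fieldType) (S : comAlgType k) := PoissonBracket {
  pbracket :> S -> S -> S;
  pbracket_linearl : forall b, linear (pbracket ^~ b);
  pbracket_linearr : forall a, linear (pbracket a);
  pbracket_alt : forall a, pbracket a a = 0;
  pbracket_jacobi : forall a b c,
    pbracket a (pbracket b c) + pbracket b (pbracket c a)
      + pbracket c (pbracket a b) = 0;
  pbracket_leibnizl : forall a b c,
    pbracket (a * b) c = a * pbracket b c + pbracket a c * b;
  pbracket_leibnizr : forall a b c,
    pbracket a (b * c) = b * pbracket a c + pbracket a b * c
}.

(* [{scalar S}] is the linear dual of S, an S-module for (s . f) a = f (s * a).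
   Linear forms are compared extensionally. *)
Record frobeniusIso (k : fieldType) (S : comAlgType k) := FrobeniusIso {
  frob_map :> S -> {scalar S};
  frob_linear : forall s b c a,
    frob_map (s * b + c) a = frob_map b (s * a) + frob_map c a;
  frob_inj : forall b c, frob_map b =1 frob_map c -> b = c;
  frob_surj : forall f : {scalar S}, exists b, frob_map b =1 f
}.

Definition frob_form (k : fieldType) (S : comAlgType k) (sigma : frobeniusIso S)
  (a b : S) : k := sigma b a.

(* A cochain P : seq S -> S encodes the family of its restrictions to sequences
   of size 0, 1, 2, ...; its component of degree k is P on sequences of size k.
   Thus the direct sum of all $\mathfrak{X}^k(S)$ sits inside [seq S -> S]. *)

Section Multiderivations.
Variables (k : fieldType) (S : comAlgType k).
Implicit Types (P Q : seq S -> S) (s : seq S).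

(* (a_1, ..., a_N) |-> (a_(th 1), ..., a_(th N)) *)
Definition rearrange s (th : 'S_(size s)) : seq S :=
  [seq s`_(th i) | i : 'I_(size s)].

Definition multider P : Prop :=
  [/\ exists N : nat, forall s, (N < size s)%N -> P s = 0,
      forall s1 s2, linear (fun a => P (s1 ++ a :: s2)),
      forall s1 s2 a b,
        P (s1 ++ a * b :: s2) = a * P (s1 ++ b :: s2) + P (s1 ++ a :: s2) * b
    & forall s (th : 'S_(size s)), P s = (-1) ^+ th * P (rearrange th)].

(* $\mathfrak{X}^m(S)$, which is 0 when m < 0 *)
Definition multider_deg (m : int) P : Prop :=
  multider P /\ forall s, (size s)%:Z != m -> P s = 0.

(* Membership in $S_{m,N-m}$ *)
Definition shuffle (m N : nat) (th : 'S_N) : bool :=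
  [forall i : 'I_N, forall j : 'I_N,
    (i < j)%N && ((j < m)%N || (m <= i)%N) ==> (th i < th j)%N].

(* On P of degree m and Q of degree n, only the m-th term of the outer sum can
   be nonzero, and only on sequences of size m + n. *)
Definition wedge P Q : seq S -> S := fun s =>
  \sum_(m < (size s).+1) \sum_(th : 'S_(size s) | shuffle m th)
    (-1) ^+ th * (P (take m (rearrange th)) * Q (drop m (rearrange th))).

(* Likewise, on P of degree m and Q of degree n, only the n-th term can be
   nonzero, and only on sequences of size m + n - 1; it vanishes for m = 0. *)
Definition circ P Q : seq S -> S := fun s =>
  \sum_(n < (size s).+1) \sum_(th : 'S_(size s) | shuffle n th)
    (-1) ^+ th * P (Q (take n (rearrange th)) :: drop n (rearrange th)).

Definition schouten (m n : int) P Q : seq S -> S :=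
  circ P Q - (-1 : k) ^ ((m - 1) * (n - 1)) *: circ Q P.

Definition cochain1 : seq S -> S := fun s => if s is [::] then 1 else 0.

Definition del (i : nat) s : seq S := take i s ++ drop i.+1 s.

Definition delta (br : poissonBracket S) P : seq S -> S := fun y =>
  \sum_(i < size y) (-1) ^+ i * br y`_i (P (del i y))
  + \sum_(i < size y) \sum_(j < size y | (i < j)%N)
      (-1) ^+ (i + j) * P (br y`_i y`_j :: del i (del j y)).

Definition bivector (br : poissonBracket S) : seq S -> S := fun s =>
  if s is [:: a; b] then br a b else 0.

(* With m - 1 = size s, the value at s is the unique d such that
   <d, a> = (-1)^(m-1) <P(s, a), 1> for all a. *)
Definition bv_op (sigma : frobeniusIso S) P : seq S -> S := fun s =>
  xget 0 [set d : S | forall a : S,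
    frob_form sigma d a
    = (-1) ^+ size s * frob_form sigma (P (rcons s a)) 1]%classic.

Lemma bv_opP (sigma : frobeniusIso S) P s a : multider P ->
  frob_form sigma (bv_op sigma P s) a
  = (-1) ^+ size s * frob_form sigma (P (rcons s a)) 1.
Proof.
move=> [_ linP _ _].
pose f (b : S) : k := (-1) ^+ size s * frob_form sigma (P (rcons s b)) 1.
have linf : scalar f.
  move=> c x y; rewrite /f /frob_form -!cats1 (linP s [::] c).
  have sigmaE u v : sigma 1 (c *: u + v) = c * sigma 1 u + sigma 1 v.
    by rewrite linearP.
  by rewrite sigmaE mulrDr mulrCA.
pose F : {scalar S} := HB.pack f (GRing.isLinear.Build _ _ _ _ f linf).
have [d defd] := frob_surj sigma F.
have formC u v : frob_form sigma u v = frob_form sigma v u.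
  have sigma0 w : sigma 0 w = 0.
    by have := frob_linear sigma (-1) 0 0 w; rewrite mulr0 addr0 mulN1r linearN addNr.
  have sigmaM u' v' : sigma u' v' = sigma 1 (u' * v').
    by have := frob_linear sigma u' 1 0 v'; rewrite mulr1 addr0 sigma0 addr0.
  by rewrite /frob_form sigmaM mulrC -sigmaM.
have dP : forall b, frob_form sigma d b
    = (-1) ^+ size s * frob_form sigma (P (rcons s b)) 1.
  by move=> b; rewrite formC; apply: defd.
by move: a; rewrite /bv_op; case: xgetP => [x _ //|/(_ d)[]]; apply: dP.
Qed.

Definition unimodular (br : poissonBracket S) (sigma : frobeniusIso S) : Prop :=
  bv_op sigma (bivector br) = 0.

End Multiderivations.

Arguments cochain1 {k} S s.

Section Cohomology.
Variables (k : fieldType) (S : comAlgType k) (br : poissonBracket S).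
Implicit Types (P Q : seq S -> S).

Lemma fct_combE (c : k) P Q s : (c *: P + Q) s = c *: P s + Q s.
Proof. by []. Qed.

Lemma multider_comb (c : k) P Q :
  multider P -> multider Q -> multider (c *: P + Q).
Proof.
case=> [[NP boundP] linP derP skewP] [[NQ boundQ] linQ derQ skewQ].
split=> [|s1 s2 d a b|s1 s2 a b|s th] /=.
- exists (maxn NP NQ) => s; rewrite gtn_max => /andP[ltP ltQ].
  by rewrite fct_combE boundP // boundQ // scaler0 addr0.
- rewrite !fct_combE (linP s1 s2 d) (linQ s1 s2 d).
  by rewrite !scalerDr !scalerA (mulrC c d) addrACA.
- rewrite !fct_combE derP derQ !scalerDr mulrDr mulrDl.
  by rewrite scalerAr scalerAl addrACA.
by rewrite !fct_combE {1}(skewP s th) {1}(skewQ s th) mulrDr scalerAr.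
Qed.

Lemma multider0 : multider (0 : seq S -> S).
Proof.
split=> [|s1 s2 d a b|s1 s2 a b|s th] /=; first by exists 0%N.
- by rewrite -[RHS]/(d *: (0 : S) + 0) scaler0 addr0.
- by rewrite -[RHS]/(a * (0 : S) + 0 * b) mulr0 mul0r addr0.
by rewrite -[RHS]/(_ * (0 : S)) mulr0.
Qed.

Lemma delta_comb (c : k) P Q :
  delta br (c *: P + Q) = c *: delta br P + delta br Q.
Proof.
apply/funext => y; rewrite fct_combE /delta scalerDr addrACA; congr (_ + _).
  rewrite scaler_sumr -big_split /=; apply: eq_bigr => i _.
  by rewrite fct_combE pbracket_linearr mulrDr scalerAr.
rewrite scaler_sumr -big_split /=; apply: eq_bigr => i _.
rewrite scaler_sumr -big_split /=; apply: eq_bigr => j _.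
by rewrite fct_combE mulrDr scalerAr.
Qed.

Lemma delta0 : delta br 0 = 0.
Proof.
by rewrite -[X in delta br X](subrr 0) -scaleN1r addrC delta_comb scaleN1r addNr.
Qed.

Definition cocycle_pred : {pred seq S -> S} :=
  fun P => `[< multider P /\ delta br P = 0 >].

Lemma cocycle_submod_closed : submod_closed cocycle_pred.
Proof.
split=> [|c P Q].
  by apply/asboolP; split; [apply: multider0 | apply: delta0].
move=> /asboolP[mP dP] /asboolP[mQ dQ]; apply/asboolP; split.
  exact: multider_comb.
by rewrite delta_comb dP dQ scaler0 addr0.
Qed.

HB.instance Definition _ :=
  GRing.isSubmodClosed.Build k (seq S -> S) cocycle_pred cocycle_submod_closed.

Record cocycle := Cocycle {
  cocycle_val :> seq S -> S;
  cocycle_valP : cocycle_val \in cocycle_pred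
}.

HB.instance Definition _ := [isSub for cocycle_val].
HB.instance Definition _ := [Choice of cocycle by <:].
HB.instance Definition _ := [SubChoice_isSubLmodule of cocycle by <:].

Definition coboundary_pred : {pred cocycle} :=
  fun z => `[< exists2 P, multider P & val z = delta br P >].

Lemma coboundary_submod_closed : submod_closed coboundary_pred.
Proof.
split=> [|c P Q].
  by apply/asboolP; exists 0; [apply: multider0 | rewrite delta0].
move=> /asboolP[P' mP defP] /asboolP[Q' mQ defQ]; apply/asboolP.
exists (c *: P' + Q'); first exact: multider_comb.
by rewrite delta_comb -defP -defQ linearP.
Qed.

HB.instance Definition _ :=
  GRing.isSubmodClosed.Build k cocycle coboundary_pred coboundary_submod_closed.

(* HP(S): all cocycles modulo all coboundaries, in all degrees at once. As delta
   is homogeneous this is the direct sum of the spaces HP^k(S). *)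
Definition HP := Quotient.quot coboundary_pred.
HB.instance Definition _ := GRing.Zmodule.on HP.

Definition HP_class (P : cocycle) : HP := (\pi_(Quotient.quot coboundary_pred) P)%qT.

Lemma HP_classP (P Q : cocycle) :
  HP_class P = HP_class Q <-> P - Q \in coboundary_pred.
Proof. by rewrite Quotient.idealrBE; split=> /eqP. Qed.

Lemma HP_class_surj (x : HP) : exists P : cocycle, HP_class P = x.
Proof. by exists (repr (x : Quotient.quot coboundary_pred)); apply: reprK. Qed.

Lemma HP_classD (P Q : cocycle) : HP_class (P + Q) = HP_class P + HP_class Q.
Proof. exact: (raddfD (\pi_(Quotient.quot coboundary_pred))%qT). Qed.

Definition HP_scale (c : k) (x : HP) : HP :=
  HP_class (c *: repr (x : Quotient.quot coboundary_pred)).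

Lemma HP_scaleE c (P : cocycle) : HP_scale c (HP_class P) = HP_class (c *: P).
Proof.
apply/HP_classP; rewrite -scalerBr; apply: rpredZ.
by apply/HP_classP; apply: reprK.
Qed.

Lemma HP_scaleA a b x : HP_scale a (HP_scale b x) = HP_scale (a * b) x.
Proof. by have [P <-] := HP_class_surj x; rewrite !HP_scaleE scalerA. Qed.

Lemma HP_scale1 x : HP_scale 1 x = x.
Proof. by have [P <-] := HP_class_surj x; rewrite HP_scaleE scale1r. Qed.

Lemma HP_scaleDr a x y : HP_scale a (x + y) = HP_scale a x + HP_scale a y.
Proof.
have [[P <-] [Q <-]] := (HP_class_surj x, HP_class_surj y).
by rewrite -HP_classD !HP_scaleE scalerDr HP_classD.
Qed.

Lemma HP_scaleDl x a b : HP_scale (a + b) x = HP_scale a x + HP_scale b x.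
Proof.
by have [P <-] := HP_class_surj x; rewrite !HP_scaleE scalerDl HP_classD.
Qed.

HB.instance Definition _ := GRing.Zmodule_isLmodule.Build k HP
  HP_scaleA HP_scale1 HP_scaleDr HP_scaleDl.

(* HP^m(S) inside HP(S) *)
Definition HP_deg (m : int) (x : HP) : Prop :=
  exists2 P : cocycle, multider_deg m P & x = HP_class P.

Lemma cochain1_cocycle : cochain1 S \in cocycle_pred.
Proof.
have br1 a : br a 1 = 0.
  have := pbracket_leibnizr br a 1 1.
  by rewrite !mul1r mulr1 -[LHS]addr0 => /addrI.
have br0 a : br a 0 = 0.
  by have := pbracket_linearr br a (-1) 0 0; rewrite !scaleN1r oppr0 addr0 addNr.
have cat0 s1 (a : S) s2 : cochain1 S (s1 ++ a :: s2) = 0 by case: s1.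
apply/asboolP; split; first split=> [|s1 s2 d a b|s1 s2 a b|s th] /=.
- by exists 0%N; case.
- by rewrite !cat0 scaler0 addr0.
- by rewrite !cat0 mulr0 mul0r addr0.
- case: s th => [|a s] th; last first.
    have: size (rearrange th) = (size s).+1 by rewrite size_image card_ord.
    by case: (rearrange th) => // x l _; rewrite /= mulr0.
  have: size (rearrange th) = 0%N by rewrite size_image card_ord.
  move/size0nil=> ->; rewrite (_ : th = 1%g) ?odd_perm1 ?mul1r //.
  by apply/permP => -[].
apply/funext => y; rewrite /delta; apply/eqP; rewrite addr_eq0; apply/eqP.
rewrite [RHS](_ : _ = 0); last first.
  apply/eqP; rewrite oppr_eq0; apply/eqP; rewrite big1 // => i _.
  by rewrite big1 // => j _; rewrite /= mulr0.
rewrite big1 // => i _; rewrite /cochain1.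
by case: (del i y) => [|a s]; rewrite /= ?br1 ?br0 mulr0.
Qed.

Definition HP_one : HP := HP_class (Cocycle cochain1_cocycle).

End Cohomology.

(* A Z-graded space is a k-module A with a family gr of subspaces indexed by
   [int] of which it is the internal direct sum. *)

Section Graded.
Variables (k : fieldType) (A : lmodType k) (gr : int -> A -> Prop).
Implicit Types (m n p : int) (a b c e : A).
Implicit Types (mul lie : A -> A -> A) (D : A -> A).

Definition bilinear_op (f : A -> A -> A) : Prop :=
  (forall b, linear (f ^~ b)) /\ (forall a, linear (f a)).

Definition graded_space : Prop :=
  [/\ forall m, gr m 0,
      forall m (x : k) a b, gr m a -> gr m b -> gr m (x *: a + b),
      forall a, exists (r : seq int) (f : int -> A),
        (forall m, gr m (f m)) /\ a = \sum_(m <- r) f m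
    & forall (r : seq int) (f : int -> A), uniq r -> (forall m, gr m (f m)) ->
        \sum_(m <- r) f m = 0 -> forall m, m \in r -> f m = 0].

Definition graded_commutative_algebra mul e : Prop :=
  [/\ graded_space /\ bilinear_op mul,
      forall a b c, mul a (mul b c) = mul (mul a b) c,
      gr 0 e /\ (forall a, mul e a = a /\ mul a e = a),
      forall m n a b, gr m a -> gr n b -> gr (m + n) (mul a b)
    & forall m n a b, gr m a -> gr n b ->
        mul a b = (-1 : k) ^ (m * n) *: mul b a].

Definition gerstenhaber_algebra mul e lie : Prop :=
  [/\ graded_commutative_algebra mul e /\ bilinear_op lie,
      forall m n a b, gr m a -> gr n b -> gr (m + n - 1) (lie a b),
      forall m n a b, gr m a -> gr n b ->
        lie a b = - ((-1 : k) ^ ((m - 1) * (n - 1)) *: lie b a),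
      forall m n p a b c, gr m a -> gr n b -> gr p c ->
        lie a (lie b c)
        = lie (lie a b) c + (-1 : k) ^ ((m - 1) * (n - 1)) *: lie b (lie a c)
    & forall m n p a b c, gr m a -> gr n b -> gr p c ->
        lie (mul a b) c
        = mul (lie a c) b + (-1 : k) ^ (m * (p - 1)) *: mul a (lie b c)].

(* A bilinear bracket is determined by this condition when gr is a grading. *)
Definition bv_bracket mul e D lie : Prop :=
  forall m n a b, gr m a -> gr n b ->
    - ((-1 : k) ^ ((m - 1) * n) *: lie a b)
    = D (mul a b) - mul (D a) b - (-1 : k) ^ m *: mul a (D b)
      + (-1 : k) ^ m *: mul (mul a (D e)) b.

Definition bv_algebra mul e D : Prop :=
  [/\ graded_commutative_algebra mul e,
      linear D,
      forall m a, gr m a -> gr (m - 1) (D a),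
      forall a, D (D a) = 0
    & exists lie, bv_bracket mul e D lie /\ gerstenhaber_algebra mul e lie].

End Graded.

Section Induced.
Variables (k : fieldType) (S : comAlgType k) (br : poissonBracket S).

(* Op sends cocycles to cocycles and f [P] = [Op P]. *)
Definition HP_induced1 (Op : (seq S -> S) -> seq S -> S) (f : HP br -> HP br) :
    Prop :=
  forall P : cocycle br, exists2 R : cocycle br,
    Op P = R & f (HP_class P) = HP_class R.

Definition HP_induced2 (Op : (seq S -> S) -> (seq S -> S) -> seq S -> S)
    (f : HP br -> HP br -> HP br) : Prop :=
  forall P Q : cocycle br, exists2 R : cocycle br,
    Op P Q = R & f (HP_class P) (HP_class Q) = HP_class R.

(* The Schouten bracket being defined on homogeneous elements, the bracket it
   induces is extended bilinearly. *)
Definition HP_induced_schouten (f : HP br -> HP br -> HP br) : Prop :=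
  bilinear_op f /\
  forall (m n : int) (P Q : cocycle br),
    multider_deg m P -> multider_deg n Q ->
    exists2 R : cocycle br,
      schouten m n P Q = R & f (HP_class P) (HP_class Q) = HP_class R.

End Induced.

(* Main.v *)
Require Import Defs.
From HB Require Import structures.
From mathcomp Require Import all_boot perm all_algebra.
From mathcomp Require Import mathcomp_extra boolp classical_sets functions.
From mathcomp Require Import ring zify.

(* Writing i_a P for P with a inserted as first argument, a shuffle product obeys
   the recursion i_a (P /\ Q) = i_a P /\ Q + (-1)^|P| P /\ i_a Q, and likewise for
   the insertion P o Q, so the Gerstenhaber identities on X(S) follow by
   induction on the list of arguments.  The form <-,-> turns Delta into
   <Delta(P)(s), a> = <P(a, s), 1>; expanding <Delta(P /\ Q)(s), a> with the
   derivation property gives the Batalin-Vilkovisky formula already on X(S),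
   without unimodularity.  Applied to Q = pi with Delta(pi) = 0 it reads
   delta(P) = Delta(P /\ pi) - Delta(P) /\ pi, whence Delta delta = - delta Delta,
   and everything passes to cohomology. *)

Set Implicit Arguments.
Unset Strict Implicit.
Unset Printing Implicit Defensive.

Import GRing.Theory.
Local Open Scope ring_scope.

(** * Shuffle sums *)

(** Cochains are functions on lists of every length, so they are inhomogeneous in general. A sign
    (-1)^|P| therefore becomes the operator [grade], and identities whose signs mix several degrees
    are stated for cochains of fixed parity. The definitions sum over permutations whose type
    depends on the list; a recursion that decides, argument by argument, into which block it goes is
    what opens them to induction.

    Insertion of one cochain into another is not associative, but its associator is graded symmetric
    in the last two entries. This pre-Lie law yields the Jacobi identity.

    That the bracket passes to cohomology is not computed from [delta]. The Batalin-Vilkovisky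
    formula writes the bracket through Delta and the wedge product, and both preserve cocycles and
    coboundaries, Delta because of unimodularity. *)

Lemma lift_perm_bij n :
  bijective (fun x : 'I_n.+1 * 'S_n => lift_perm x.1 ord0 x.2).
Proof.
apply: inj_card_bij => [[i th] [j th'] /= eq_g|]; last first.
  by rewrite card_prod !card_Sn card_ord factS.
have eq_ij : i = j.
  apply: (@perm_inj _ (lift_perm i ord0 th)).
  by rewrite {2}eq_g !lift_perm_id.
rewrite -{}eq_ij in eq_g *; congr (_, _); apply/permP => x.
by move/permP/(_ (lift i x)): eq_g; rewrite !lift_perm_lift; apply: lift_inj.
Qed.

(** [i] is the position at which the head of a list lands, [th] the rearrangement of its tail: this
    turns a sum over permutations into a recursion on the list. *)
Lemma sum_lift_perm (V : nmodType) n (P : pred 'S_n.+1) (f : 'S_n.+1 -> V) :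
  \sum_(th | P th) f th
  = \sum_i \sum_(th | P (lift_perm i ord0 th)) f (lift_perm i ord0 th).
Proof.
by rewrite pair_big_dep (reindex _ (onW_bij _ (lift_perm_bij n))).
Qed.

(** The smallest value must open one of the two increasing blocks, so it sits at position 0 or [m].
    For [m] = 0 these coincide, and the condition [0 < m] prevents counting such a permutation
    twice. *)
Lemma shuffle_lift n (m : nat) (i : 'I_n.+1) (th : 'S_n) :
  shuffle m (lift_perm i ord0 th)
  = (i == m :> nat) && shuffle m th
    || [&& i == 0%N :> nat, (0 < m)%N & shuffle m.-1 th].
Proof.
have shP N p (t : 'S_N) : reflect
    (forall x y : 'I_N, (x < y)%N -> (y < p)%N || (p <= x)%N -> (t x < t y)%N)
    (shuffle p t).
  apply: (iffP forallP) => [h x y ltxy pxy|h x].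
    by move/forallP/(_ y)/implyP: (h x); apply; rewrite ltxy.
  by apply/forallP => y; apply/implyP => /andP[]; apply: h.
have liftE (x y : 'I_n) : (lift_perm i ord0 th (lift i x)
    < lift_perm i ord0 th (lift i y))%N = (th x < th y)%N.
  by rewrite !lift_perm_lift.
apply/idP/idP => [/shP h|].
  have i0m : i = 0%N :> nat \/ i = m :> nat.
    have lt0 (x : 'I_n.+1) : (x < i)%N -> (i < m)%N || (m <= x)%N -> False.
      by move=> ltxi /(h x i ltxi); rewrite lift_perm_id ltn0.
    case: (ltngtP i m) => [ltim|ltmi|]; last by right.
      by left; case: (posnP i) => // /(lt0 ord0); rewrite ltim; case.
    have ltm : (m < n.+1)%N by apply: ltn_trans ltmi _.
    by case: (lt0 (Ordinal ltm)); rewrite //= leqnn orbT.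
  have [eqim|neqim] /= := eqVneq (i : nat) m.
    apply/orP; left; apply/shP => x y ltxy pxy; rewrite -liftE.
    by apply: h; rewrite /= /bump; lia.
  have i0 : i = 0%N :> nat by case: i0m => // /eqP; rewrite (negPf neqim).
  rewrite i0 /= lt0n eq_sym -i0 neqim; apply/shP => x y ltxy pxy; rewrite -liftE.
  by apply: h; rewrite /= /bump; lia.
move=> him; apply/shP => x y; case: (unliftP i y) => [y' ->|->] ltxy pxy; last first.
  by case/orP: him => [/andP[/eqP eqi _]|/and3P[/eqP eqi _ _]]; lia.
case: (unliftP i x) ltxy pxy => [x' ->|->] ltxy pxy; last first.
  by rewrite lift_perm_id lift_perm_lift.
rewrite liftE; move: ltxy pxy; rewrite /= /bump => ltxy pxy.
by case/orP: him => [/andP[/eqP eqi /shP]|/and3P[/eqP eqi m0 /shP]]; apply; lia.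
Qed.

Section ShuffleSums.
Variables (k : fieldType) (S : comAlgType k).
Implicit Types (F G : seq S -> seq S -> S) (s A B : seq S).

(** Each argument joins the first or the second block; in the latter case it has moved past the
    whole first block, whence the sign. *)
Fixpoint shuffle_sum F s : S :=
  if s is a :: s' then
    shuffle_sum (fun A B => F (a :: A) B) s'
    + shuffle_sum (fun A B => (-1) ^+ size A * F A (a :: B)) s'
  else F [::] [::].

(** This is [rearrange] with [n] detached from [size s], so that induction on the list does not
    disturb the type of the permutation. *)
Definition permute (n : nat) s (th : 'S_n) : seq S := [seq s`_(th i) | i : 'I_n].

Lemma size_permute n s (th : 'S_n) : size (permute s th) = n.
Proof. by rewrite size_map size_enum_ord. Qed.

Lemma nth_permute n s (th : 'S_n) (i : 'I_n) : (permute s th)`_i = s`_(th i).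
Proof. by rewrite (nth_map i) ?size_enum_ord // nth_ord_enum. Qed.

Lemma permute_lift n s a (i : 'I_n.+1) (th : 'S_n) :
  permute (a :: s) (lift_perm i ord0 th)
  = take i (permute s th) ++ a :: drop i (permute s th).
Proof.
have szr : size (take i (permute s th)) = i.
  by apply: size_takel; rewrite size_permute -ltnS.
apply: (@eq_from_nth _ 0) => [|j].
  by rewrite size_permute size_cat /= addnS -size_cat cat_take_drop size_permute.
rewrite size_permute => ltj; rewrite -[j]/(nat_of_ord (Ordinal ltj)) nth_permute.
set jo := Ordinal ltj; case: (unliftP i jo) => [j' ->|->]; last first.
  by rewrite lift_perm_id nth_cat szr ltnn subnn.
rewrite lift_perm_lift /= nth_cat szr /bump.
case: (leqP i j') => [le_ij|lt_ji].
  rewrite add1n ltnNge (leqW le_ij) /= subSn //= nth_drop subnKC //.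
  by rewrite nth_permute.
by rewrite add0n lt_ji nth_take // nth_permute.
Qed.

(** Sorting the permutations by the position of the head leaves, by [shuffle_lift], the positions 0
    and [m]: these are the two branches of the recursion. *)
Lemma sum_shuffleE F s :
  \sum_(m < (size s).+1) \sum_(th : 'S_(size s) | shuffle m th)
    (-1) ^+ th * F (take m (rearrange th)) (drop m (rearrange th))
  = shuffle_sum F s.
Proof.
suff gen n : size s = n -> \sum_(m < n.+1) \sum_(th : 'S_n | shuffle m th)
    (-1) ^+ th * F (take m (permute s th)) (drop m (permute s th))
    = shuffle_sum F s.
  exact: gen.
elim: s n F => [|a s IHs] [|n] F //= => [_|[szs]].
  rewrite big_ord1 (bigD1 (1%g : 'S_0)) /=; last by apply/forallP => -[].
  rewrite big1 => [|th /andP[_ /eqP[]]]; last by apply/permP => -[].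
  have -> : permute [::] (1%g : 'S_0) = [::] :> seq S.
    by apply: size0nil; rewrite size_permute.
  by rewrite odd_perm1 mul1r addr0.
rewrite -!(IHs n) //.
pose T m i (th : 'S_n) := (-1) ^+ lift_perm i ord0 th * F
  (take m (permute (a :: s) (lift_perm i ord0 th)))
  (drop m (permute (a :: s) (lift_perm i ord0 th))).
have T0 m th : T m.+1 ord0 th
    = (-1) ^+ th * F (a :: take m (permute s th)) (drop m (permute s th)).
  by rewrite /T permute_lift odd_lift_perm take0 drop0.
have Tm (i : 'I_n.+1) th : T i i th = (-1) ^+ th * ((-1) ^+ size (take i (permute s th))
      * F (take i (permute s th)) (a :: drop i (permute s th))).
  rewrite /T permute_lift odd_lift_perm /=.
  have szt : size (take i (permute s th)) = i.
    by apply: size_takel; rewrite size_permute -ltnS.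
  rewrite take_cat drop_cat szt ltnn subnn take0 cats0 drop0.
  by rewrite signr_addb addbF signr_odd mulrCA mulrA.
transitivity (\sum_(m < n.+2) \sum_(i < n.+1)
  (\sum_(th | (i == m :> nat) && shuffle m th) T m i th
   + \sum_(th | [&& i == 0%N :> nat, (0 < m)%N & shuffle m.-1 th]) T m i th)).
  apply: eq_bigr => m _; rewrite sum_lift_perm; apply: eq_bigr => i _.
  rewrite big_mkcond [X in _ = X + _]big_mkcond [X in _ = _ + X]big_mkcond.
  rewrite -big_split /=; apply: eq_bigr => th _.
  rewrite shuffle_lift -/(T m i th).
  have [<-|//] := eqVneq (i : nat) m; last by rewrite /= add0r.
  by case: posnP => [i0|i0]; rewrite ?i0 ?(gtn_eqF i0) /= ?orbF ?addr0.
under eq_bigr => m _ do rewrite big_split /=.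
rewrite big_split /= addrC; congr (_ + _).
  rewrite big_ord_recl /= big1 ?add0r => [|i _]; last first.
    by rewrite big_pred0 // => th; rewrite andbF.
  apply: eq_bigr => m _; rewrite (bigD1 ord0) //= [X in _ + X]big1 ?addr0.
    by apply: eq_bigr => th _; rewrite T0.
  move=> i ni0; rewrite big_pred0 // => th; apply/negbTE.
  by apply: contra ni0 => /andP[/eqP i0 _]; apply/eqP/val_inj.
rewrite exchange_big; apply: eq_bigr => i _ /=.
rewrite (bigD1 (widen_ord (leqnSn _) i)) //= [X in _ + X]big1 ?addr0 => [|m nmi].
  by rewrite eqxx; apply: eq_bigr => th _; rewrite Tm.
rewrite big_pred0 // => th; apply/negbTE; apply: contra nmi => /andP[/eqP eqim _].
by apply/eqP/val_inj.
Qed.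

End ShuffleSums.

(** * Multiderivations and adjacent transpositions *)
Section Cochains.
Variables (k : fieldType) (S : comAlgType k).
Implicit Types (P Q R : seq S -> S) (s : seq S) (a b c : S).

Definition adjacent_skew P : Prop :=
  forall s1 a b s2, P (s1 ++ a :: b :: s2) = - P (s1 ++ b :: a :: s2).
Definition multilinear P : Prop :=
  forall s1 s2, linear (fun a => P (s1 ++ a :: s2)).
Definition multiderivation P : Prop :=
  forall s1 s2 a b,
    P (s1 ++ a * b :: s2) = a * P (s1 ++ b :: s2) + P (s1 ++ a :: s2) * b.
Definition bounded P : Prop :=
  exists N : nat, forall s, (N < size s)%N -> P s = 0.

Definition insert a P : seq S -> S := fun s => P (a :: s).
(** The sign (-1)^|P| as an operator, so that graded formulas make sense for inhomogeneous
    cochains. *)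
Definition grade P : seq S -> S := fun s => (-1) ^+ size s * P s.

Lemma multilinear0 P s1 s2 : multilinear P -> P (s1 ++ 0 :: s2) = 0.
Proof.
move=> linP; have := linP s1 s2 (-1) 0 0.
by rewrite scaler0 addr0 scaleN1r addNr.
Qed.

Lemma skew_insert a P : adjacent_skew P -> adjacent_skew (insert a P).
Proof. by move=> skP s1; apply: (skP (a :: s1)). Qed.

Lemma skew_move P s1 a s2 : adjacent_skew P ->
  P (s1 ++ a :: s2) = (-1) ^+ size s1 * P (a :: s1 ++ s2).
Proof.
elim: s1 P => [|x s1 IHs] P skP /=; first by rewrite mul1r.
rewrite -[P (x :: _)]/(insert x P (s1 ++ a :: s2)) IHs; last exact: skew_insert.
by rewrite /insert (skP [::]) exprS mulN1r mulrN mulNr.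
Qed.

(** No factorization of [th] into adjacent transpositions is needed: the head is carried back from
    position [i] at the cost of (-1)^i, and induction applied to [insert a P] treats the tail. *)
Lemma skew_permute P n s (th : 'S_n) : adjacent_skew P -> size s = n ->
  P s = (-1) ^+ th * P (permute s th).
Proof.
elim: n P s th => [|n IHn] P s th skP szs.
  rewrite (_ : th = 1%g) ?odd_perm1 ?mul1r; last by apply/permP => -[].
  by rewrite (size0nil szs); congr P; rewrite [RHS]size0nil ?size_permute.
case: s szs => // a s [szs]; have [g _ gK] := lift_perm_bij n.
rewrite -[th]gK; case: (g th) => i {}th /=.
rewrite permute_lift skew_move // cat_take_drop odd_lift_perm addbF.
rewrite size_takel ?size_permute -1?ltnS // signr_addb signr_odd.
rewrite -[P (a :: s)]/(insert a P s) (IHn _ _ th (skew_insert a skP) szs).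
by rewrite -mulrA [RHS]mulrCA signrMK.
Qed.

Lemma permute_adjacent s1 s2 a b :
  exists2 th : 'S_(size (s1 ++ a :: b :: s2)), odd_perm th &
    permute (s1 ++ a :: b :: s2) th = s1 ++ b :: a :: s2.
Proof.
set s := s1 ++ _.
have szE : size s = (size s1 + (size s2).+2)%N by rewrite size_cat.
have lt1 : (size s1 < size s)%N by rewrite szE; lia.
have lt2 : ((size s1).+1 < size s)%N by rewrite szE; lia.
exists (tperm (Ordinal lt1) (Ordinal lt2)).
  by rewrite odd_tperm -val_eqE /= neq_ltn ltnSn.
apply: (@eq_from_nth _ 0) => [|j].
  by rewrite size_permute !size_cat.
rewrite size_permute => ltj; rewrite -[j]/(nat_of_ord (Ordinal ltj)) nth_permute.
case: tpermP => [->|->|ne1 ne2] /=.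
- by rewrite !nth_cat ltnn ltnNge leqnSn /= subnn subSnn.
- by rewrite !nth_cat ltnn ltnNge leqnSn /= subnn subSnn.
rewrite /s !nth_cat; case: ltnP => // le1.
have {}ne1 : j <> size s1 by move=> eqj; apply: ne1; apply: val_inj.
have {}ne2 : j <> (size s1).+1 by move=> eqj; apply: ne2; apply: val_inj.
by have -> : (j - size s1)%N = (j - size s1).-2.+2 by lia.
Qed.

(** Adjacent swaps are expressed without the length of the list, so this form of skew-symmetry
    passes directly to [insert a P]; it is the one used in all inductions. *)
Lemma multiderP P :
  multider P <-> [/\ bounded P, multilinear P, multiderivation P & adjacent_skew P].
Proof.
split=> -[bdP linP derP skP]; split=> //; last by move=> s th; apply: skew_permute.
move=> s1 a b s2; have [th oddth eqth] := permute_adjacent s1 s2 a b.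
by rewrite (skP _ th) oddth expr1 mulN1r; congr (- P _).
Qed.

End Cochains.

(** * Wedge product and insertion *)
Section ShuffleSumTheory.
Variables (k : fieldType) (S : comAlgType k).
Implicit Types (F G : seq S -> seq S -> S) (s A B : seq S).

Lemma eq_shuffle_sum F G s :
  (forall A B, (size A + size B)%N = size s -> F A B = G A B) ->
  shuffle_sum F s = shuffle_sum G s.
Proof.
elim: s F G => [|a s IHs] F G eqFG /=; first exact: eqFG.
congr (_ + _); apply: IHs => A B szAB; last congr (_ * _).
  by apply: eqFG; rewrite /= addSn szAB.
by apply: eqFG; rewrite /= addnS szAB.
Qed.

Lemma shuffle_sum_comb c d F G s :
  shuffle_sum (fun A B => c * F A B + d * G A B) s
  = c * shuffle_sum F s + d * shuffle_sum G s.
Proof.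
elim: s F G => [|a s IHs] F G //=; rewrite IHs.
have -> : shuffle_sum (fun A B => (-1) ^+ size A * (c * F A (a :: B) + d * G A (a :: B))) s
  = shuffle_sum (fun A B => c * ((-1) ^+ size A * F A (a :: B))
       + d * ((-1) ^+ size A * G A (a :: B))) s.
  by apply: eq_shuffle_sum => A B _; ring.
by rewrite IHs; ring.
Qed.

Lemma shuffle_sumZ c F s :
  shuffle_sum (fun A B => c * F A B) s = c * shuffle_sum F s.
Proof.
rewrite -[RHS]addr0 -[X in _ + X](mul0r (shuffle_sum F s)) -shuffle_sum_comb.
by apply: eq_shuffle_sum => A B _; rewrite mul0r addr0.
Qed.

Lemma shuffle_sum0 F s :
  (forall A B, (size A + size B)%N = size s -> F A B = 0) -> shuffle_sum F s = 0.
Proof.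
move=> F0; rewrite -[RHS](mul0r (shuffle_sum F s)) -shuffle_sumZ.
by apply: eq_shuffle_sum => A B /F0 ->; rewrite mul0r.
Qed.

(** Serves to compare [sigma a] of one shuffle sum with [sigma 1] of another term by term, although
    the form takes its values in [k] and not in [S]. *)
Lemma shuffle_sum_morph (V : zmodType) (g h : {additive S -> V}) F G s :
  (forall A B, (size A + size B)%N = size s -> g (F A B) = h (G A B)) ->
  g (shuffle_sum F s) = h (shuffle_sum G s).
Proof.
elim: s F G => [|a s IHs] F G eqFG /=; first exact: eqFG.
rewrite !raddfD /=; congr (_ + _); apply: IHs => A B szAB.
  by apply: eqFG; rewrite /= addSn szAB.
rewrite -signr_odd !mulr_sign.
have eqAB : g (F A (a :: B)) = h (G A (a :: B)) by apply: eqFG; rewrite /= addnS szAB.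
by case: ifP => _; rewrite ?raddfN eqAB.
Qed.

Lemma shuffle_sumC F s :
  shuffle_sum F s
  = shuffle_sum (fun A B => (-1) ^+ (size A * size B) * F B A) s.
Proof.
elim: s F => [|a s IHs] F /=; first by rewrite mul1r.
rewrite addrC; congr (_ + _); rewrite IHs; apply: eq_shuffle_sum => A B _ /=.
  by rewrite mulrA -exprD addnC mulSn.
rewrite mulrA -exprD mulnS; congr (_ * _).
by rewrite -[LHS]signr_odd -[RHS]signr_odd !oddD addbA addbb.
Qed.

End ShuffleSumTheory.

Section WedgeCirc.
Variables (k : fieldType) (S : comAlgType k).
Implicit Types (P Q R : seq S -> S) (s A B : seq S) (a b c d : S).

(** The coefficients lie in [S], not in [k]: the Leibniz rule for an inserted product, [insert_mul],
    produces such combinations. *)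
Definition comb c P d Q : seq S -> S := fun s => c * P s + d * Q s.

Lemma wedgeE P Q s : wedge P Q s = shuffle_sum (fun A B => P A * Q B) s.
Proof. exact: (sum_shuffleE (fun A B => P A * Q B)). Qed.

Lemma circE P Q s : circ P Q s = shuffle_sum (fun A B => P (Q A :: B)) s.
Proof. exact: (sum_shuffleE (fun A B => P (Q A :: B))). Qed.

Lemma wedge_nil P Q : wedge P Q [::] = P [::] * Q [::].
Proof. by rewrite wedgeE. Qed.

Lemma circ_nil P Q : circ P Q [::] = P [:: Q [::]].
Proof. by rewrite circE. Qed.

Lemma insert_wedge a P Q :
  insert a (wedge P Q) = wedge (insert a P) Q + wedge (grade P) (insert a Q).
Proof.
apply/funext => s; rewrite /insert [LHS]wedgeE /= -[RHS]/(_ s + _ s) !wedgeE.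
by congr (_ + _); apply: eq_shuffle_sum => A B _; rewrite mulrA.
Qed.

Lemma grade_comb c P d Q : grade (comb c P d Q) = comb c (grade P) d (grade Q).
Proof. by apply/funext => s; rewrite /grade /comb; ring. Qed.

Lemma wedge_combl c P d P' Q :
  wedge (comb c P d P') Q = comb c (wedge P Q) d (wedge P' Q).
Proof.
apply/funext => s; rewrite /comb !wedgeE -shuffle_sum_comb.
by apply: eq_shuffle_sum => A B _; ring.
Qed.

Lemma wedge_combr c Q d Q' P :
  wedge P (comb c Q d Q') = comb c (wedge P Q) d (wedge P Q').
Proof.
apply/funext => s; rewrite /comb !wedgeE -shuffle_sum_comb.
by apply: eq_shuffle_sum => A B _; ring.
Qed.

Lemma addfE P Q : P + Q = comb 1 P 1 Q.
Proof. by apply/funext => s; rewrite /comb !mul1r. Qed.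

Lemma scalefE (x : k) P : x *: P = comb x%:A P 0 0.
Proof. by apply/funext => s; rewrite /comb mulr_algl mul0r addr0. Qed.

Lemma wedgeDl P P' Q : wedge (P + P') Q = wedge P Q + wedge P' Q.
Proof. by rewrite !addfE wedge_combl. Qed.

Lemma wedgeDr P Q Q' : wedge P (Q + Q') = wedge P Q + wedge P Q'.
Proof. by rewrite !addfE wedge_combr. Qed.

Lemma wedge0 P : wedge P 0 = 0.
Proof. by apply: (addrI (wedge P 0)); rewrite -wedgeDr !addr0. Qed.

Lemma wedge0l P : wedge 0 P = 0.
Proof. by apply: (addrI (wedge 0 P)); rewrite -wedgeDl !addr0. Qed.

Lemma wedgeNl P Q : wedge (- P) Q = - wedge P Q.
Proof. by apply: (addrI (wedge P Q)); rewrite -wedgeDl !subrr wedge0l. Qed.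

Lemma wedgeNr P Q : wedge P (- Q) = - wedge P Q.
Proof. by apply: (addrI (wedge P Q)); rewrite -wedgeDr !subrr wedge0. Qed.

Lemma wedgeZl (x : k) P Q : wedge (x *: P) Q = x *: wedge P Q.
Proof.
rewrite !scalefE wedge_combl; congr comb; exact: wedge0l.
Qed.

Lemma wedgeZr (x : k) P Q : wedge P (x *: Q) = x *: wedge P Q.
Proof.
rewrite !scalefE wedge_combr; congr comb; exact: wedge0.
Qed.

Lemma gradeK : involutive (@grade k S).
Proof. by move=> P; apply/funext => s; rewrite /grade signrMK. Qed.

Lemma gradeD P Q : grade (P + Q) = grade P + grade Q.
Proof. by rewrite !addfE grade_comb. Qed.

Lemma gradeN P : grade (- P) = - grade P.
Proof. by apply/funext => s; rewrite /grade mulrN. Qed.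

Lemma gradeZ (x : k) P : grade (x *: P) = x *: grade P.
Proof. by apply/funext => s; rewrite /grade -scalerAr. Qed.

Lemma insert_grade a P : insert a (grade P) = - grade (insert a P).
Proof. by apply/funext => s; rewrite /insert /grade /= exprS mulN1r mulNr. Qed.

Lemma grade_wedge P Q : grade (wedge P Q) = wedge (grade P) (grade Q).
Proof.
apply/funext => s; rewrite /grade !wedgeE -shuffle_sumZ.
by apply: eq_shuffle_sum => A B <-; rewrite exprD; ring.
Qed.

Lemma wedge_cons a P Q s :
  wedge P Q (a :: s) = wedge (insert a P) Q s + wedge (grade P) (insert a Q) s.
Proof. by have /(congr1 (@^~ s)) := insert_wedge a P Q. Qed.

Lemma wedgeA P Q R : wedge P (wedge Q R) = wedge (wedge P Q) R.
Proof.
apply/funext => s; elim: s P Q R => [|a s IHs] P Q R.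
  by rewrite !wedge_nil mulrA.
rewrite !wedge_cons !insert_wedge wedgeDl wedgeDr grade_wedge.
by rewrite -[LHS]/(_ + (_ s + _ s)) -[RHS]/((_ s + _ s) + _) !IHs addrA.
Qed.

(* All signs below depend on degrees only modulo 2. *)
Definition parity (b : bool) P : Prop := forall s, odd (size s) != b -> P s = 0.

Lemma wedgeC (b c : bool) P Q : parity b P -> parity c Q ->
  wedge P Q = (-1 : k) ^+ (b && c) *: wedge Q P.
Proof.
move=> parP parQ; apply/funext => s; rewrite -[RHS]/(_ *: wedge Q P s) !wedgeE shuffle_sumC.
rewrite -mulr_algl -shuffle_sumZ; apply: eq_shuffle_sum => A B _.
rewrite mulr_algl [Q A * _]mulrC.
have [oddA|/parQ ->] := eqVneq (odd (size A)) c; last by rewrite !mulr0 scaler0.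
have [oddB|/parP ->] := eqVneq (odd (size B)) b; last by rewrite !mul0r mulr0 scaler0.
rewrite -signr_odd oddM oddA oddB scaler_sign mulr_sign.
by case: b c {oddA oddB parP parQ} => -[].
Qed.

Lemma insert_one a : insert a (cochain1 S) = 0.
Proof. by []. Qed.

Lemma wedge1 P : wedge P (cochain1 S) = P.
Proof.
apply/funext => s; elim: s P => [|a s IHs] P.
  by rewrite wedge_nil mulr1.
rewrite wedge_cons IHs insert_one wedge0.
exact: addr0.
Qed.

Lemma wedge1l P : wedge (cochain1 S) P = P.
Proof.
apply/funext => s; elim: s P => [|a s IHs] P.
  by rewrite wedge_nil mul1r.
rewrite wedge_cons insert_one wedge0l.
rewrite (_ : grade _ = cochain1 S) ?IHs ?add0r //.
by apply/funext => -[|x l]; rewrite /grade ?mul1r //= mulr0.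
Qed.

Lemma skew_grade P : adjacent_skew P -> adjacent_skew (grade P).
Proof. by move=> skP s1 a b s2; rewrite /grade skP mulrN !size_cat. Qed.

Lemma multilinear_grade P : multilinear P -> multilinear (grade P).
Proof.
move=> linP s1 s2 x a b; rewrite /grade linP !size_cat /= mulrDr.
by rewrite scalerAr.
Qed.

Lemma multiderivation_grade P : multiderivation P -> multiderivation (grade P).
Proof. by move=> derP s1 s2 a b; rewrite /grade derP !size_cat /=; ring. Qed.

Lemma addcE P Q s : (P + Q) s = P s + Q s. Proof. by []. Qed.
Lemma oppcE P s : (- P) s = - P s. Proof. by []. Qed.
Lemma scalecE (x : k) P s : (x *: P) s = x *: P s. Proof. by []. Qed.

Lemma skew_insert2 a b P : adjacent_skew P ->
  insert a (insert b P) = - insert b (insert a P).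
Proof. by move=> skP; apply/funext => s; apply: (skP [::]). Qed.

Lemma wedge_skew P Q :
  adjacent_skew P -> adjacent_skew Q -> adjacent_skew (wedge P Q).
Proof.
move=> skP skQ s1; elim: s1 P Q skP skQ => [|x s1 IHs] P Q skP skQ a b s2 /=.
  (* Since insertion anticommutes with [grade], swapping [a] and [b] exchanges the two mixed terms
     up to sign; the other two terms are skew because insertions anticommute. *)
  rewrite !wedge_cons !insert_grade !gradeK (skew_insert2 b a skP).
  by rewrite (skew_insert2 b a skQ) !wedgeNl !wedgeNr !oppcE; ring.
rewrite !wedge_cons opprD; congr (_ + _); apply: IHs => //.
  exact: skew_insert.
all: by [apply: skew_grade | apply: skew_insert].
Qed.

Lemma insert_multilinear a P : multilinear P -> multilinear (insert a P).
Proof. by move=> linP s1; apply: (linP (a :: s1)). Qed.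

Lemma insert_multiderivation a P : multiderivation P -> multiderivation (insert a P).
Proof. by move=> derP s1; apply: (derP (a :: s1)). Qed.

Lemma insert_linear (x : k) a b P : multilinear P ->
  insert (x *: a + b) P = x *: insert a P + insert b P.
Proof. by move=> linP; apply/funext => s; apply: (linP [::]). Qed.

Lemma insert_mul a b P : multiderivation P ->
  insert (a * b) P = comb a (insert b P) b (insert a P).
Proof.
by move=> derP; apply/funext => s; rewrite /insert (derP [::]) /comb [_ * b]mulrC.
Qed.

Lemma wedge_multilinear P Q :
  multilinear P -> multilinear Q -> multilinear (wedge P Q).
Proof.
move=> linP linQ s1; elim: s1 P Q linP linQ => [|y s1 IHs] P Q linP linQ s2 x a b /=.
  rewrite !wedge_cons !insert_linear // wedgeDl wedgeDr wedgeZl wedgeZr.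
  by rewrite !addcE !scalecE scalerDr addrACA.
rewrite !wedge_cons !IHs ?scalerDr 1?addrACA //;
  by [apply: insert_multilinear | apply: multilinear_grade].
Qed.

Lemma wedge_multiderivation P Q :
  multiderivation P -> multiderivation Q -> multiderivation (wedge P Q).
Proof.
move=> derP derQ s1; elim: s1 P Q derP derQ => [|y s1 IHs] P Q derP derQ s2 a b /=.
  rewrite !wedge_cons !insert_mul // wedge_combl wedge_combr /comb; ring.
rewrite !wedge_cons !IHs; first by ring.
all: by [| apply: insert_multiderivation | apply: multiderivation_grade].
Qed.

Lemma wedge_bounded P Q : bounded P -> bounded Q -> bounded (wedge P Q).
Proof.
move=> [M bdP] [N bdQ]; exists (M + N)%N => s lts.
rewrite wedgeE shuffle_sum0 // => A B szAB.
case: (ltnP M (size A)) => [/bdP ->|leA]; first by rewrite mul0r.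
by rewrite bdQ ?mulr0 //; lia.
Qed.

Lemma multider_wedge P Q : multider P -> multider Q -> multider (wedge P Q).
Proof.
move=> /multiderP[bdP linP derP skP] /multiderP[bdQ linQ derQ skQ].
apply/multiderP; split; [exact: wedge_bounded | exact: wedge_multilinear |
  exact: wedge_multiderivation | exact: wedge_skew].
Qed.

Lemma multider_grade P : multider P -> multider (grade P).
Proof.
move=> /multiderP[[N bdP] linP derP skP]; apply/multiderP; split.
- by exists N => s /bdP; rewrite /grade => ->; rewrite mulr0.
- exact: multilinear_grade.
- exact: multiderivation_grade.
- exact: skew_grade.
Qed.

(** * Insertion of one cochain into another *)

Lemma circ_combl c P d P' Q :
  circ (comb c P d P') Q = comb c (circ P Q) d (circ P' Q).
Proof.
apply/funext => s; rewrite /comb !circE -shuffle_sum_comb.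
exact: eq_shuffle_sum.
Qed.

Lemma circDl P P' Q : circ (P + P') Q = circ P Q + circ P' Q.
Proof. by rewrite !addfE circ_combl. Qed.

Lemma circ0l P : circ 0 P = 0.
Proof. by apply: (addrI (circ 0 P)); rewrite -circDl !addr0. Qed.

Lemma circNl P Q : circ (- P) Q = - circ P Q.
Proof. by apply: (addrI (circ P Q)); rewrite -circDl !subrr circ0l. Qed.

Lemma circZl (x : k) P Q : circ (x *: P) Q = x *: circ P Q.
Proof. by rewrite !scalefE circ_combl circ0l. Qed.

Lemma circ_linear (x : k) P Q Q' : multilinear P ->
  circ P (x *: Q + Q') = x *: circ P Q + circ P Q'.
Proof.
move=> linP; apply/funext => s; rewrite addcE scalecE !circE -(mulr_algl x (shuffle_sum _ _)).
rewrite -[X in _ = _ + X]mul1r -shuffle_sum_comb; apply: eq_shuffle_sum => A B _.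
by rewrite (linP [::]) mul1r mulr_algl.
Qed.

Lemma circ0 P : multilinear P -> circ P 0 = 0.
Proof.
move=> linP; have := circ_linear (-1) 0 0 linP.
by rewrite scaler0 addr0 scaleN1r addNr.
Qed.

Lemma circDr P Q Q' : multilinear P -> circ P (Q + Q') = circ P Q + circ P Q'.
Proof. by move=> linP; have := circ_linear 1 Q Q' linP; rewrite !scale1r. Qed.

Lemma circZr (x : k) P Q : multilinear P -> circ P (x *: Q) = x *: circ P Q.
Proof. by move=> linP; have := circ_linear x Q 0 linP; rewrite circ0 // !addr0. Qed.

Lemma circNr P Q : multilinear P -> circ P (- Q) = - circ P Q.
Proof. by move=> linP; rewrite -!scaleN1r circZr. Qed.

Lemma multilinearN P s1 a s2 : multilinear P ->
  P (s1 ++ - a :: s2) = - P (s1 ++ a :: s2).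
Proof.
move=> linP; have := linP s1 s2 (-1) a 0.
by rewrite multilinear0 // !addr0 !scaleN1r.
Qed.

(** The argument [a] goes to [Q] or to [P]. In the second case it passes the block of [Q], which
    gives [grade Q], and then the value of [Q] itself, which gives the minus sign. *)
Lemma insert_circ a P Q : multilinear P -> adjacent_skew P ->
  insert a (circ P Q) = circ P (insert a Q) - circ (insert a P) (grade Q).
Proof.
move=> linP skP; apply/funext => s; rewrite /insert [LHS]circE /= addcE oppcE !circE.
congr (_ + _); rewrite -[RHS]mulN1r -shuffle_sumZ; apply: eq_shuffle_sum => A B _.
(* [P] is linear over [k] only, so a sign, which here is a factor in [S], leaves its argument by a
   case split on the parity. *)
rewrite (skP [::]) /= /grade -signr_odd !mulr_sign; case: ifP => _; last by rewrite mulN1r.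
by rewrite opprK (multilinearN [:: a]) // mulN1r opprK.
Qed.

Lemma circ_cons a P Q s : multilinear P -> adjacent_skew P ->
  circ P Q (a :: s) = circ P (insert a Q) s - circ (insert a P) (grade Q) s.
Proof. by move=> linP skP; have /(congr1 (@^~ s)) := insert_circ a Q linP skP. Qed.

(** The extra sign reflects that P o Q has degree |P| + |Q| - 1. *)
Lemma grade_circ P Q : multilinear P ->
  grade (circ P Q) = - circ (grade P) (grade Q).
Proof.
move=> linP; apply/funext => s; rewrite oppcE -[- _]mulN1r /grade !circE -!shuffle_sumZ.
apply: eq_shuffle_sum => A B <- /=; rewrite exprD exprS !mulN1r.
rewrite -[(-1) ^+ size A]signr_odd; case: (odd _); rewrite /= ?mulN1r ?mul1r; last by ring.
rewrite (multilinearN [::] _ _ linP) /=; ring.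
Qed.

Lemma circ_skew P Q : multilinear P -> adjacent_skew P -> adjacent_skew Q ->
  adjacent_skew (circ P Q).
Proof.
move=> linP skP skQ s1; elim: s1 P Q linP skP skQ => [|x s1 IHs] P Q linP skP skQ a b s2 /=.
  rewrite !circ_cons //; try by [exact: skew_insert| exact: insert_multilinear].
  rewrite !insert_grade !gradeK (skew_insert2 b a skP) (skew_insert2 b a skQ).
  rewrite !circNl !circNr //; try by exact: insert_multilinear.
  rewrite !oppcE; ring.
rewrite !circ_cons // opprD.
congr (_ + _); [|congr (- _)]; apply: IHs => //.
all: by [exact: skew_insert| exact: insert_multilinear | exact: skew_grade].
Qed.

Lemma circ_multilinear P Q : multilinear P -> adjacent_skew P -> multilinear Q ->
  multilinear (circ P Q).
Proof.
move=> linP skP linQ s1.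
elim: s1 P Q linP skP linQ => [|x s1 IHs] P Q linP skP linQ s2 y a b /=.
  rewrite !circ_cons // !insert_linear // circDl circDr // circZl circZr //.
  by rewrite !addcE !scalecE scalerBr opprD addrACA.
rewrite !circ_cons // !IHs; first by rewrite scalerBr opprD addrACA.
all: by [| exact: skew_insert| exact: insert_multilinear | exact: multilinear_grade].
Qed.

End WedgeCirc.

(** * Gerstenhaber identities *)
Section Gerstenhaber.
Variables (k : fieldType) (S : comAlgType k).
Implicit Types (P Q R : seq S -> S) (s A B : seq S) (a b : S) (c d e : bool).

(** For [R] of parity [c], [twist (~~ c) P] is (-1)^(|P|(|R|-1)) P: inserting [R] is an operation of
    degree |R| - 1, and this is the sign for moving it past [P]. *)
Definition twist c P : seq S -> S := if c then grade P else P.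

Lemma grade_parity c P : parity c P -> grade P = if c then - P else P.
Proof.
move=> parP; apply/funext => s; rewrite /grade -signr_odd mulr_sign.
have [->|/parP P0] := eqVneq (odd (size s)) c; first by case: (c).
by case: (c); rewrite ?oppcE P0 oppr0 if_same.
Qed.

Lemma parity_insert c a P : parity c P -> parity (~~ c) (insert a P).
Proof. by move=> parP s ne; apply: parP; move: ne => /=; case: odd; case: c. Qed.

Lemma parity_grade c P : parity c P -> parity c (grade P).
Proof. by move=> parP s ne; rewrite /grade parP // mulr0. Qed.

(** The value of [R] is an argument of P /\ Q, hence is fed either to [P] or to [Q]. *)
Lemma circ_wedgel c P Q R :
  multilinear P -> adjacent_skew P -> multilinear Q -> adjacent_skew Q -> parity c R ->
  circ (wedge P Q) R = wedge (circ P R) Q + wedge (twist (~~ c) P) (circ Q R).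
Proof.
move=> linP skP linQ skQ parR; apply/funext => s.
elim: s c P Q R linP skP linQ skQ parR => [|a s IHs] c P Q R linP skP linQ skQ parR.
  rewrite addcE circ_nil wedge_cons !wedge_nil !circ_nil /insert /=.
  by congr (_ + _ * _); case: c {parR}; rewrite /= /grade ?mul1r.
rewrite circ_cons; [|exact: wedge_multilinear|exact: wedge_skew].
rewrite insert_wedge circDl 2!addcE !wedge_cons !insert_circ // grade_circ //.
have pari := parity_insert a parR; have parg := parity_grade parR.
rewrite (IHs _ _ _ _ linP skP linQ skQ pari).
rewrite (IHs _ _ _ _ (insert_multilinear a linP) (skew_insert a skP) linQ skQ parg).
rewrite (IHs _ _ _ _ (multilinear_grade linP) (skew_grade skP)
  (insert_multilinear a linQ) (skew_insert a skQ) parg).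
rewrite !addcE !wedgeDl !wedgeDr !wedgeNl !wedgeNr (grade_parity parR) negbK.
have linPa := insert_multilinear a linP; have linPg := multilinear_grade linP.
have linQa := insert_multilinear a linQ.
case: c {parR pari parg} => /=; rewrite ?insert_grade ?gradeK ?circNr //;
  rewrite ?wedgeNl ?wedgeNr !addcE !oppcE; ring.
Qed.

(** This is the Leibniz rule of [R] in the argument that receives P /\ Q; it is applied on the empty
    list, and the induction tracks the signs. *)
Lemma circ_wedger c P Q R :
  multilinear R -> adjacent_skew R -> multiderivation R -> parity c R ->
  circ R (wedge P Q) = wedge P (circ R Q) + wedge (circ R P) (twist (~~ c) Q).
Proof.
move=> linR skR derR parR; apply/funext => s.
elim: s c P Q R linR skR derR parR => [|a s IHs] c P Q R linR skR derR parR.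
  rewrite addcE circ_nil !wedge_nil !circ_nil (derR [::]) /=.
  by congr (_ + _ * _); case: c {parR}; rewrite /= /grade ?mul1r.
rewrite circ_cons // insert_wedge grade_wedge circDr // 2!addcE !wedge_cons.
rewrite !insert_circ // grade_circ //.
have pari := parity_insert a parR.
rewrite !(IHs _ _ _ _ linR skR derR parR).
rewrite (IHs _ _ _ _ (insert_multilinear a linR) (skew_insert a skR)
  (insert_multiderivation a derR) pari).
rewrite !addcE !wedgeDl !wedgeDr !wedgeNl !wedgeNr (grade_parity parR) negbK.
case: c {parR pari} => /=; rewrite ?insert_grade ?gradeK ?circNl //;
  rewrite ?wedgeNl ?wedgeNr !addcE !oppcE; ring.
Qed.

Definition associator P Q R := circ (circ P Q) R - circ P (circ Q R).

Lemma associatorN2 P Q R : multilinear P ->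
  associator P (- Q) R = - associator P Q R.
Proof.
by move=> linP; rewrite /associator circNr // !circNl circNr // opprB opprK addrC.
Qed.

Lemma associatorN3 P Q R : multilinear P -> adjacent_skew P -> multilinear Q ->
  associator P Q (- R) = - associator P Q R.
Proof.
move=> linP skP linQ; rewrite /associator !circNr // ?opprB 1?addrC ?opprK //.
exact: circ_multilinear.
Qed.

(** The three terms correspond to [a] being consumed by [R], by [Q] or by [P]. *)
Lemma associator_cons a P Q R s :
  multilinear P -> adjacent_skew P -> multilinear Q -> adjacent_skew Q ->
  associator P Q R (a :: s)
  = associator P Q (insert a R) s - associator P (insert a Q) (grade R) s
    + associator (insert a P) (grade Q) (grade R) s.
Proof.
move=> linP skP linQ skQ; rewrite /associator !addcE !oppcE.
rewrite !circ_cons //; [|exact: circ_multilinear|exact: circ_skew].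
rewrite !insert_circ // grade_circ // !circDl !circDr // !circNl !circNr //; last first.
  exact: insert_multilinear.
by rewrite !addcE !oppcE; ring.
Qed.

(* Up to sign, both sides are the sum of all ways of inserting Q and R
   into distinct arguments of P. *)
Lemma associator_sym c d P Q R :
  multilinear P -> adjacent_skew P -> multilinear Q -> adjacent_skew Q ->
  multilinear R -> adjacent_skew R -> parity c Q -> parity d R ->
  associator P Q R = (-1 : k) ^+ (~~ c && ~~ d) *: associator P R Q.
Proof.
move=> linP skP linQ skQ linR skR parQ parR; apply/funext => s; rewrite scalecE scaler_sign.
elim: s c d P Q R linP skP linQ skQ linR skR parQ parR
  => [|a s IHs] c d P Q R linP skP linQ skQ linR skR parQ parR.
  have P0 s1 s2 : P (s1 ++ 0 :: s2) = 0 by apply: multilinear0.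
  have assoc0 P' Q' R' : multilinear P' -> adjacent_skew P' ->
      associator P' Q' R' [::] = - P' [:: R' [::]; Q' [::]].
    move=> linP' skP'; rewrite /associator addcE oppcE !circ_nil circ_cons // !circE /=.
    by rewrite /insert /grade /= mul1r addrAC subrr add0r.
  (* An odd cochain vanishes on the empty list, so only even [Q] and [R] remain, and there the sign
     is the skew-symmetry of [P]. *)
  rewrite !assoc0 //; case: c parQ => [/(_ [::] isT) ->|parQ].
    by rewrite (P0 [::]) // (P0 [:: _]) // oppr0 if_same.
  case: d parR => [/(_ [::] isT) ->|parR].
    by rewrite (P0 [::]) // (P0 [:: _]) // oppr0 if_same.
  by rewrite opprK (skP [::]) opprK.
have linPa := insert_multilinear a linP; have skPa := skew_insert a skP.
have linQa := insert_multilinear a linQ; have skQa := skew_insert a skQ.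
have linRa := insert_multilinear a linR; have skRa := skew_insert a skR.
have parQa := parity_insert a parQ; have parRa := parity_insert a parR.
rewrite !associator_cons // (grade_parity parQ) (grade_parity parR).
have := IHs _ _ _ _ _ linP skP linQ skQ linRa skRa parQ parRa.
have := IHs _ _ _ _ _ linP skP linQa skQa linR skR parQa parR.
have := IHs _ _ _ _ _ linPa skPa linQ skQ linR skR parQ parR.
case: c {parQ parQa}; case: d {parR parRa} => /= e1 e2 e3;
  rewrite ?associatorN2 ?associatorN3 ?associatorN2 // ?oppcE ?e1 ?e2 ?e3; ring.
Qed.

End Gerstenhaber.

(** * The operator Delta and the Poisson differential *)
Section BVOperator.
Variables (k : fieldType) (S : comAlgType k) (sigma : frobeniusIso S).
Implicit Types (P Q R : seq S -> S) (s : seq S) (a b : S).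

(** By S-linearity the isomorphism is determined by the Frobenius functional [sigma 1], and the form
    becomes [sigma 1 (a * b)], which is visibly symmetric. *)
Lemma frobM a b : sigma a b = sigma 1 (a * b).
Proof.
have sigma0 w : sigma 0 w = 0.
  by have := frob_linear sigma (-1) 0 0 w; rewrite mulr0 addr0 mulN1r linearN addNr.
by have := frob_linear sigma a 1 0 b; rewrite mulr1 addr0 sigma0 addr0.
Qed.

Lemma frobN a b : sigma a (- b) = - sigma a b.
Proof. exact: raddfN. Qed.

Lemma frob_nondegenerate a b :
  (forall c, sigma 1 (a * c) = sigma 1 (b * c)) -> a = b.
Proof. by move=> eqab; apply: (@frob_inj _ _ sigma) => c; rewrite frobM [RHS]frobM. Qed.

(** The sign in the definition of Delta is exactly the cost of moving the last argument to the
    front. *)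
Lemma bv_opE P s a : multider P ->
  sigma 1 (bv_op sigma P s * a) = sigma 1 (P (a :: s)).
Proof.
move=> mP; have := bv_opP sigma s a mP; have [_ _ _ skP] := (multiderP P).1 mP.
rewrite /frob_form frobM mulrC => ->; rewrite -cats1 skew_move // cats0.
rewrite -signr_odd mulr_sign -[X in sigma 1 (X * _)]signr_odd mulr_sign.
by case: odd; rewrite ?raddfN ?opprK.
Qed.

Lemma bv_op_unique P s d : multider P ->
  (forall a, sigma 1 (d * a) = sigma 1 (P (a :: s))) -> bv_op sigma P s = d.
Proof. by move=> mP dP; apply: frob_nondegenerate => a; rewrite bv_opE. Qed.

Lemma bv_op_linear (x : k) P Q : multider P -> multider Q ->
  bv_op sigma (x *: P + Q) = x *: bv_op sigma P + bv_op sigma Q.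
Proof.
move=> mP mQ; apply/funext => s; apply: bv_op_unique => [|a].
  exact: multider_comb.
by rewrite !addcE !scalecE mulrDl -scalerAl !linearP !bv_opE.
Qed.

Lemma multiderivation1 P s1 s2 : multiderivation P -> P (s1 ++ 1 :: s2) = 0.
Proof.
move=> derP; have := derP s1 s2 1 1.
by rewrite !mul1r mulr1 -{1}[P _]addr0 => /addrI.
Qed.

Lemma multider_bv_op P : multider P -> multider (bv_op sigma P).
Proof.
move=> mP; have [[N bdP] linP derP skP] := (multiderP P).1 mP.
apply/multiderP; split=> [|s1 s2 x a b|s1 s2 a b|s1 a b s2].
- exists N => s lts; apply: bv_op_unique => // a.
  by rewrite mul0r bdP // ltnW.
- apply: bv_op_unique => // c.
  by rewrite mulrDl -scalerAl !linearP !bv_opE // (linP (c :: s1)) linearP.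
- apply: bv_op_unique => // c.
  (* Moving the factors [a] and [b] across the form makes [P] differentiate them in its first
     argument as well. The two surplus terms have [a] and [b] in exchanged positions and cancel by
     this skew-symmetry. *)
  have sk x y : P (x :: s1 ++ y :: s2) = - P (y :: s1 ++ x :: s2).
    have move2 u v : P (u :: s1 ++ v :: s2) = (-1) ^+ size s1 * P [:: u, v & s1 ++ s2].
      exact: (skew_move _ _ _ (skew_insert u skP)).
    by rewrite !move2 (skP [::]) mulrN.
  set X := bv_op _ _ _; set Y := bv_op _ _ _.
  have -> : (a * X + Y * b) * c = X * (a * c) + Y * (b * c) by ring.
  rewrite linearD !bv_opE // (derP (c :: s1)) (derP [::]) (derP [::]) -linearD /=.
  by rewrite (sk b a); congr (sigma 1 _); ring.
apply: bv_op_unique => // c.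
by rewrite mulNr !frobN bv_opE // (skP (c :: s1)) frobN opprK.
Qed.

(** Two applications of the adjunction, the second one paired with 1, put a 1 among the arguments of
    [P], and a derivation kills 1. *)
Lemma bv_op_square P : multider P -> bv_op sigma (bv_op sigma P) = 0.
Proof.
move=> mP; have mD := multider_bv_op mP; apply/funext => s.
apply: bv_op_unique => // a; rewrite mul0r -[bv_op _ _ _]mulr1 bv_opE //.
by rewrite (multiderivation1 [::]) //; case: mP.
Qed.

Lemma multider_one : multider (cochain1 S).
Proof.
apply/multiderP; split=> [|s1 s2 x a b|s1 s2 a b|s1 a b s2].
- by exists 0%N; case.
- by case: s1 => [|y s1]; rewrite /= scaler0 addr0.
- by case: s1 => [|y s1]; rewrite /= mulr0 mul0r addr0.
- by case: s1 => [|y s1]; rewrite /= oppr0.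
Qed.

Lemma bv_op_one : bv_op sigma (cochain1 S) = 0.
Proof.
apply/funext => s; apply: bv_op_unique => [|a]; first exact: multider_one.
by rewrite mul0r.
Qed.

(** Insertion with [Q] evaluated on the second block, the order in which it comes out of P /\ Q when
    Delta is expanded. *)
Definition circ_last P Q : seq S -> S :=
  fun s => shuffle_sum (fun A B => P (Q B :: A)) s.

(** Exchanging the blocks costs (-1)^(|A||B|), and the block fed to [Q] has parity [c] wherever its
    term survives. *)
Lemma circ_lastE c P Q : multilinear P -> parity c Q ->
  circ_last P Q = if c then - circ (grade P) Q else circ P Q.
Proof.
move=> linP parQ; suff E s : circ_last P Q s
    = (-1) ^+ c * circ (twist c P) Q s.
  by apply/funext => s; rewrite E; case: (c); rewrite ?mul1r // oppcE mulN1r.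
rewrite circE /circ_last shuffle_sumC -shuffle_sumZ; apply: eq_shuffle_sum => A B _.
have P0 : P (0 :: B) = 0 by apply: (@multilinear0 _ _ _ [::]).
have [oddA|/parQ ->] := eqVneq (odd (size A)) c; last first.
  by rewrite P0 /twist; case: (c); rewrite /grade ?P0 !mulr0.
rewrite -signr_odd oddM oddA; case: (c); rewrite /twist ?mul1r //=.
by rewrite /grade /= expr1 exprS signr_odd; ring.
Qed.

(** In the pairing with [a], the product of [a] and [Q B] is moved into the first argument of [P].
    The Leibniz rule there yields a term of the inserted wedge product and a multiple of P(Q(B), A).
    The same with [P] and [Q] exchanged gives the other insertion term. *)
Lemma bv_op_wedge P Q : multider P -> multider Q ->
  bv_op sigma (wedge P Q)
  = wedge (bv_op sigma P) Q + wedge (grade P) (bv_op sigma Q)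
    - circ_last P Q - circ Q (grade P).
Proof.
move=> mP mQ; apply/funext => s; apply: bv_op_unique => [|a].
  exact: multider_wedge.
have [_ linP derP skP] := (multiderP P).1 mP.
have [_ linQ derQ skQ] := (multiderP Q).1 mQ.
have eP : sigma a (wedge (bv_op sigma P) Q s)
    = sigma 1 (wedge (insert a P) Q s + a * circ_last P Q s).
  rewrite -[wedge (insert a P) Q s]mul1r !wedgeE -shuffle_sum_comb.
  apply: shuffle_sum_morph => A B _.
  rewrite -[LHS]/(sigma a (_ * _)) -[RHS]/(sigma 1 (_ + _)).
  rewrite frobM mulrCA bv_opE // (derP [::]) /insert /=.
  by congr (sigma 1 _); ring.
have eQ : sigma a (wedge (grade P) (bv_op sigma Q) s)
    = sigma 1 (wedge (grade P) (insert a Q) s + a * circ Q (grade P) s).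
  rewrite -[wedge _ (insert a Q) s]mul1r circE !wedgeE -shuffle_sum_comb.
  apply: shuffle_sum_morph => A B _.
  rewrite -[LHS]/(sigma a (_ * _)) -[RHS]/(sigma 1 (_ + _)).
  rewrite (_ : sigma a _ = sigma 1 (bv_op sigma Q B * (a * grade P A))); last first.
    by rewrite frobM; congr (sigma 1 _); ring.
  rewrite bv_opE // (derQ [::]) /insert /=.
  by congr (sigma 1 _); ring.
rewrite mulrC -frobM !addcE !oppcE !linearB linearD eP eQ wedge_cons.
by rewrite [sigma a (circ_last _ _ _)]frobM [sigma a (circ _ _ _)]frobM !linearD /=; ring.
Qed.

End BVOperator.

(** * The Poisson differential in terms of the bivector *)

Section PoissonDifferential.
Variables (k : fieldType) (S : comAlgType k) (br : poissonBracket S).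
Implicit Types (P Q R : seq S -> S) (s : seq S) (a b : S).

Let pi := bivector br.

Lemma pbracket_skew a b : br a b = - br b a.
Proof.
have brDl x y z : br (x + y) z = br x z + br y z.
  by have := pbracket_linearl br z 1 x y; rewrite !scale1r.
have brDr x y z : br x (y + z) = br x y + br x z.
  by have := pbracket_linearr br x 1 y z; rewrite !scale1r.
apply/eqP; rewrite -addr_eq0; apply/eqP.
by have := pbracket_alt br (a + b); rewrite brDl !brDr !pbracket_alt add0r addr0.
Qed.

Lemma multider_bivector : multider pi.
Proof.
apply/multiderP; split=> [|s1 s2 x a b|s1 s2 a b|s1 a b s2].
- by exists 2%N => -[|? [|? [|]]].
- case: s1 s2 => [|y [|z s1]] [|t [|u s2]]; rewrite /= ?scaler0 ?addr0 //;
    by [apply: pbracket_linearl | apply: pbracket_linearr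
       | case: s1 => [|? ?]; rewrite /= ?scaler0 ?addr0].
- case: s1 s2 => [|y [|z s1]] [|t [|u s2]]; rewrite /= ?mulr0 ?mul0r ?addr0 //;
    by [apply: pbracket_leibnizl | apply: pbracket_leibnizr
       | case: s1 => [|? ?]; rewrite /= ?mulr0 ?mul0r ?addr0].
- case: s1 s2 => [|y [|z s1]] [|t s2]; rewrite /= ?oppr0 //;
    by [apply: pbracket_skew | case: s1 => [|? ?]; rewrite /= ?oppr0].
Qed.

Lemma parity_bivector : parity false pi.
Proof. by case=> [|a [|b [|c s]]]. Qed.

Lemma circ_size0 P Q : (forall s, (0 < size s)%N -> Q s = 0) -> multilinear P ->
  adjacent_skew P -> circ P Q = insert (Q [::]) P.
Proof.
move=> Q0 linP skP; apply/funext => s; elim: s P linP skP => [|a s IHs] P linP skP.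
  by rewrite circ_nil.
rewrite circ_cons // (_ : insert a Q = 0); last by apply/funext => l; apply: Q0.
rewrite circ0 // (_ : grade Q = Q); last first.
  apply/funext => -[|x l]; rewrite /grade ?mul1r // Q0 //= ?mulr0 //.
rewrite IHs; [|exact: insert_multilinear|exact: skew_insert].
by rewrite sub0r /insert (skP [::]) opprK.
Qed.

Lemma circ_size1 P Q : (forall s, size s != 1 -> P s = 0) ->
  circ P Q = fun s => P [:: Q s].
Proof.
move=> P1; apply/funext => s; rewrite circE.
elim: s Q => [|a s IHs] Q //=; rewrite (IHs (insert a Q)).
by rewrite [X in _ + X]shuffle_sum0 ?addr0 // => A B _; rewrite P1 ?mulr0.
Qed.

Lemma sum_ord_del_cons (F : nat -> S -> seq S -> S) a s :
  \sum_(i < (size s).+1) F i (a :: s)`_i (del i (a :: s))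
  = F 0%N a s + \sum_(i < size s) F i.+1 s`_i (a :: del i s).
Proof. by rewrite big_ord_recl /= /del take0 /= drop0. Qed.

(** In degree m this reads delta(P) = -[P, pi]_S: the brackets with a value of [P] make up the first
    term, the brackets inside [P] the second. *)
Lemma deltaE P : multider P -> delta br P = - circ pi (grade P) - circ P pi.
Proof.
move=> /multiderP[_ linP _ skP].
have [_ linpi _ skpi] := (multiderP pi).1 multider_bivector.
have pia0 a : insert a pi = fun s => if s is [:: b] then br a b else 0.
  by apply/funext => -[|? []].
apply/funext => y; rewrite /delta addcE !oppcE; congr (_ + _).
  elim: y P linP skP => [|a s IHs] P linP skP.
    by rewrite big_ord0 circ_nil /= oppr0.
  rewrite /= (sum_ord_del_cons (fun i b l => (-1) ^+ i * br b (P l))) mul1r.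
  under eq_bigr => i _ do rewrite exprS mulN1r mulNr.
  rewrite sumrN; have /= -> := IHs _ (insert_multilinear a linP) (skew_insert a skP).
  rewrite circ_cons // gradeK insert_grade circNr //.
  rewrite [circ (insert a pi) P]circ_size1; last by rewrite pia0 => -[|? []].
  by rewrite oppcE /insert /=; ring.
(* The row i = 0 of the double sum, where the head [a] is bracketed with a later argument; position
   [j] in the tail is position [j.+1] in the list. *)
have U a P' s : multilinear P' -> adjacent_skew P' ->
    \sum_(j < size s) (-1) ^+ j.+1 * P' (br a s`_j :: del j s)
    = - circ P' (insert a pi) s.
  elim: s P' => [|b s IHs] P' linP' skP'.
    by rewrite big_ord0 circ_nil pia0 (@multilinear0 _ _ _ [::]) // oppr0.
  rewrite /= (sum_ord_del_cons (fun j b l => (-1) ^+ j.+1 * P' (br a b :: l))).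
  under eq_bigr => j _ do rewrite exprS mulN1r mulNr (skP' [::]) mulrN opprK.
  have /= -> := IHs _ (insert_multilinear b linP') (skew_insert b skP').
  rewrite circ_cons // (@circ_size0 P') //; last by case=> // x l _; apply: erefl.
  rewrite (grade_parity (parity_insert a parity_bivector)) /=.
  rewrite circNr; last exact: insert_multilinear.
  by rewrite oppcE /insert /= expr1; ring.
elim: y P linP skP => [|a s IHs] P linP skP.
  by rewrite big_ord0 circ_nil /= (@multilinear0 _ _ _ [::]) // oppr0.
rewrite /= big_ord_recl big_mkcond big_ord_recl /= add0r.
under eq_bigr => j _ do rewrite /bump add0n /del /=.
rewrite circ_cons // opprB addrC; congr (_ + _); last first.
  by rewrite -U //; apply: eq_bigr => j _; rewrite add0n drop0.
(* In the rows i > 0 the head [a] stands just behind the bracket; swapping the two gives minus the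
   double sum for [insert a P]. *)
rewrite (grade_parity parity_bivector) /= -[RHS]opprK.
rewrite -(IHs _ (insert_multilinear a linP) (skew_insert a skP)) -sumrN.
apply: eq_bigr => i _; rewrite big_mkcond big_ord_recl /= add0r -sumrN.
rewrite [RHS]big_mkcond; apply: eq_bigr => j _ /=; rewrite /bump !add1n ltnS.
case: ifP => // _; rewrite /insert /= (skP [::]) mulrN addnS addSn !exprS.
by rewrite !mulN1r opprK.
Qed.

End PoissonDifferential.

(** * Cocycles and coboundaries *)
Section ParitySchouten.
Variables (k : fieldType) (S : comAlgType k).
Implicit Types (P Q R : seq S -> S) (s : seq S) (b c d : bool).

Definition psign b : k := (-1) ^+ b.

(** The Schouten bracket with degrees reduced modulo 2, so that checking signs is a finite case
    analysis on Booleans. *)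
Definition pschouten b c P Q : seq S -> S :=
  circ P Q - psign (~~ b && ~~ c) *: circ Q P.

Lemma psignZ b P : psign b *: P = if b then - P else P.
Proof. by rewrite /psign scaler_sign. Qed.

Lemma pschouten_anti b c P Q :
  pschouten b c P Q = - (psign (~~ b && ~~ c) *: pschouten c b Q P).
Proof.
apply/funext => s; rewrite /pschouten !psignZ [~~ c && _]andbC.
by case: (_ && _); rewrite !(oppcE, addcE); ring.
Qed.

Lemma pschouten_leibniz b c d P Q R :
  multider P -> multider Q -> multider R -> parity b P -> parity c Q -> parity d R ->
  pschouten (b (+) c) d (wedge P Q) R
  = wedge (pschouten b d P R) Q
    + psign (b && ~~ d) *: wedge P (pschouten c d Q R).
Proof.
move=> /multiderP[_ linP derP skP] /multiderP[_ linQ derQ skQ] /multiderP[_ linR derR skR].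
move=> parP parQ parR; rewrite /pschouten (circ_wedgel linP skP linQ skQ parR).
rewrite (circ_wedger P Q linR skR derR parR) /twist.
apply/funext => s; rewrite !psignZ (grade_parity parP) (grade_parity parQ).
case: b c d {parP parQ parR} => -[] [] /=;
  rewrite ?(wedgeDl, wedgeDr, wedgeNl, wedgeNr, addcE, oppcE); ring.
Qed.

(** The commutator of a graded pre-Lie product satisfies the graded Jacobi identity: three instances
    of [associator_sym], with [P], [Q] and [R] in turn as outer cochain, account for all twelve
    double insertions. *)
Lemma pschouten_jacobi b c d P Q R :
  multider P -> multider Q -> multider R -> parity b P -> parity c Q -> parity d R ->
  pschouten b (~~ (c (+) d)) P (pschouten c d Q R)
  = pschouten (~~ (b (+) c)) d (pschouten b c P Q) R
    + psign (~~ b && ~~ c) *: pschouten c (~~ (b (+) d)) Q (pschouten b d P R).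
Proof.
move=> /multiderP[_ linP derP skP] /multiderP[_ linQ derQ skQ] /multiderP[_ linR derR skR].
move=> parP parQ parR; apply/funext => s.
have := congr1 (@^~ s) (associator_sym linP skP linQ skQ linR skR parQ parR).
have := congr1 (@^~ s) (associator_sym linQ skQ linP skP linR skR parP parR).
have := congr1 (@^~ s) (associator_sym linR skR linP skP linQ skQ parP parQ).
rewrite /associator -/(psign _) -/(psign _) -/(psign _) /pschouten !psignZ.
case: b c d {parP parQ parR} => -[] [] /=;
  rewrite ?(circDl, circNl, circDr, circNr, addcE, oppcE) //.
all: move=> /(canRL (subrK _)) e1 /(canRL (subrK _)) e2 /(canRL (subrK _)) e3.
all: by rewrite e1 e2 e3; ring.
Qed.
End ParitySchouten.

Section Cocycles.
Variables (k : fieldType) (S : comAlgType k).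
Variables (br : poissonBracket S) (sigma : frobeniusIso S).
Implicit Types (P Q R : seq S -> S) (s : seq S) (b c d : bool).

(** Cuts out the even part, the odd part or a single homogeneous component of a cochain. *)
Definition size_restrict (p : pred nat) P : seq S -> S :=
  fun s => if p (size s) then P s else 0.

Lemma restrict_linear p (x : k) P Q :
  size_restrict p (x *: P + Q) = x *: size_restrict p P + size_restrict p Q.
Proof.
apply/funext => s; rewrite /size_restrict !addcE !scalecE.
by case: ifP; rewrite ?scaler0 ?addr0.
Qed.

Lemma multider_restrict p P : multider P -> multider (size_restrict p P).
Proof.
move=> /multiderP[[N bdP] linP derP skP]; rewrite /size_restrict.
apply/multiderP; split=> [|s1 s2 x a b|s1 s2 a b|s1 a b s2].
- by exists N => s /bdP ->; rewrite if_same.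
- by rewrite !size_cat /=; case: ifP => _; rewrite ?linP // scaler0 addr0.
- by rewrite !size_cat /=; case: ifP => _; rewrite ?derP // mulr0 mul0r addr0.
- by rewrite !size_cat /= skP; case: ifP => _; rewrite ?oppr0.
Qed.

Lemma delta_restrict p P :
  delta br (size_restrict p P) = size_restrict (p \o predn) (delta br P).
Proof.
have br0 a : br a 0 = 0.
  by have := pbracket_linearr br a (-1) 0 0; rewrite scaler0 addr0 scaleN1r addNr.
apply/funext => y; rewrite /size_restrict /delta /=.
have szdel (i : 'I_(size y)) : size (del i y) = (size y).-1.
  rewrite /del size_cat size_drop size_takel; last exact: ltnW.
  by have := ltn_ord i; lia.
have szdel2 (i j : 'I_(size y)) : (i < j)%N -> (size (del i (del j y))).+1 = (size y).-1.
  move=> ltij; rewrite /del size_cat size_drop size_takel -/(del j y) szdel; last first.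
    by have := ltn_ord j; lia.
  by have := ltn_ord j; lia.
case: ifP => py; last first.
  rewrite big1 ?add0r => [|i _]; last by rewrite szdel py br0 mulr0.
  by rewrite big1 // => i _; rewrite big1 // => j ltij /=; rewrite szdel2 // py mulr0.
congr (_ + _); first by apply: eq_bigr => i _; rewrite szdel py.
by apply: eq_bigr => i _; apply: eq_bigr => j ltij /=; rewrite szdel2 // py.
Qed.

Lemma delta_grade P : multider P -> delta br (grade P) = - grade (delta br P).
Proof.
move=> mP; have [_ linpi _ skpi] := (multiderP _).1 (multider_bivector br).
have [_ linP _ skP] := (multiderP _).1 mP.
rewrite !deltaE //; last exact: multider_grade.
rewrite gradeD !gradeN !grade_circ // gradeK (grade_parity (parity_bivector br)).
by rewrite !opprK opprD.
Qed.

Lemma delta_wedge P Q : multider P -> multider Q ->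
  delta br (wedge P Q) = wedge (delta br P) Q + wedge (grade P) (delta br Q).
Proof.
move=> mP mQ; have [_ linpi derpi skpi] := (multiderP _).1 (multider_bivector br).
have [_ linP _ skP] := (multiderP _).1 mP; have [_ linQ _ skQ] := (multiderP _).1 mQ.
have parpi := parity_bivector br.
rewrite !deltaE //; last exact: multider_wedge.
rewrite grade_wedge (circ_wedgel linP skP linQ skQ parpi).
rewrite (circ_wedger _ _ linpi skpi derpi parpi) /= gradeK.
rewrite !wedgeDl !wedgeDr !wedgeNl !wedgeNr.
by apply/funext => s; rewrite !(addcE, oppcE); ring.
Qed.

Definition poisson_cocycle P := multider P /\ delta br P = 0.
Definition poisson_coboundary P := exists2 X, multider X & P = delta br X.

Lemma cocycle_comb (x : k) P Q :
  poisson_cocycle P -> poisson_cocycle Q -> poisson_cocycle (x *: P + Q).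
Proof.
move=> [mP dP] [mQ dQ]; split; first exact: multider_comb.
by rewrite delta_comb dP dQ scaler0 addr0.
Qed.

Lemma coboundary_comb (x : k) P Q :
  poisson_coboundary P -> poisson_coboundary Q -> poisson_coboundary (x *: P + Q).
Proof.
move=> [X mX ->] [Y mY ->]; exists (x *: X + Y); first exact: multider_comb.
by rewrite delta_comb.
Qed.

Lemma coboundaryN P : poisson_coboundary P -> poisson_coboundary (- P).
Proof.
move=> cP; rewrite -[- P]addr0 -scaleN1r; apply: coboundary_comb => //.
by exists 0; [apply: multider0 | rewrite delta0].
Qed.

Lemma cocycle_wedge P Q :
  poisson_cocycle P -> poisson_cocycle Q -> poisson_cocycle (wedge P Q).
Proof.
move=> [mP dP] [mQ dQ]; split; first exact: multider_wedge.
by rewrite delta_wedge // dP dQ wedge0 wedge0l addr0.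
Qed.

Lemma coboundary_wedgel P Q :
  poisson_coboundary P -> poisson_cocycle Q -> poisson_coboundary (wedge P Q).
Proof.
move=> [X mX ->] [mQ dQ]; exists (wedge X Q); first exact: multider_wedge.
by rewrite delta_wedge // dQ wedge0 addr0.
Qed.

Lemma coboundary_wedger P Q :
  poisson_cocycle P -> poisson_coboundary Q -> poisson_coboundary (wedge P Q).
Proof.
move=> [mP dP] [X mX ->]; exists (wedge (grade P) X).
  by apply: multider_wedge => //; apply: multider_grade.
rewrite delta_wedge ?gradeK ?delta_grade ?dP //; last exact: multider_grade.
rewrite (_ : grade 0 = 0) ?oppr0 ?wedge0l ?add0r //.
by apply/funext => s; rewrite /grade mulr0.
Qed.

Lemma cocycle_restrict p P : poisson_cocycle P -> poisson_cocycle (size_restrict p P).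
Proof.
move=> [mP dP]; split; first exact: multider_restrict.
by rewrite delta_restrict dP; apply/funext => s; rewrite /size_restrict if_same.
Qed.

Lemma coboundary_restrict p P :
  poisson_coboundary P -> poisson_coboundary (size_restrict p P).
Proof.
move=> [X mX ->]; exists (size_restrict (p \o succn) X); first exact: multider_restrict.
rewrite delta_restrict; apply/funext => -[|a s]; rewrite /size_restrict //=.
(* On the empty list [predn] truncates and the two size conditions may differ, but [delta] vanishes
   there. *)
rewrite (_ : delta br X [::] = 0) ?if_same //.
by rewrite /delta !big_ord0 addr0.
Qed.

Lemma cocycle_grade P : poisson_cocycle P -> poisson_cocycle (grade P).
Proof.
move=> [mP dP]; split; first exact: multider_grade.
rewrite delta_grade // dP; apply/funext => s; rewrite /grade oppcE mulr0 oppr0 //.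
Qed.

Lemma coboundary_grade P : poisson_coboundary P -> poisson_coboundary (grade P).
Proof.
move=> [X mX ->]; exists (- grade X).
  rewrite -[- _]addr0 -scaleN1r; apply: multider_comb; last exact: multider0.
  exact: multider_grade.
by rewrite -[- _]addr0 -scaleN1r delta_comb delta0 addr0 scaleN1r delta_grade // opprK.
Qed.

(** * Unimodularity, Delta and the bracket on cocycles *)

Hypothesis unimod : unimodular br sigma.

Lemma bv_op0 : bv_op sigma (0 : seq S -> S) = 0.
Proof.
have m0 := multider0 S; have := bv_op_linear sigma (-1) m0 m0.
by rewrite scaler0 addr0 scaleN1r addNr.
Qed.

Lemma delta_bvE P : multider P ->
  delta br P = bv_op sigma (wedge P (bivector br)) - wedge (bv_op sigma P) (bivector br).
Proof.
move=> mP; have [_ linP _ skP] := (multiderP _).1 mP.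
have mpi := multider_bivector br.
rewrite bv_op_wedge // (_ : bv_op sigma (bivector br) = 0) // wedge0 addr0.
rewrite (circ_lastE linP (parity_bivector br)) deltaE //.
by apply/funext => s; rewrite !(addcE, oppcE); ring.
Qed.

(** Apply Delta to [delta_bvE] for P, and [delta_bvE] itself to Delta(P): as Delta squares to zero,
    each side keeps only the term Delta(Delta(P) /\ pi), with opposite signs. *)
Lemma bv_op_delta P : multider P ->
  bv_op sigma (delta br P) = - delta br (bv_op sigma P).
Proof.
move=> mP; have mpi := multider_bivector br.
have mD := multider_bv_op sigma mP.
rewrite (delta_bvE mD) bv_op_square // wedge0l subr0.
have mw := multider_wedge mP mpi; rewrite delta_bvE // addrC -scaleN1r.
rewrite bv_op_linear ?bv_op_square ?addr0 ?scaleN1r //; last exact: multider_bv_op.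
exact: multider_wedge.
Qed.

Lemma cocycle_bv_op P : poisson_cocycle P -> poisson_cocycle (bv_op sigma P).
Proof.
move=> [mP dP]; split; first exact: multider_bv_op.
by apply: oppr_inj; rewrite -bv_op_delta // dP bv_op0 oppr0.
Qed.

Lemma coboundary_bv_op P : poisson_coboundary P -> poisson_coboundary (bv_op sigma P).
Proof.
move=> [X mX ->]; rewrite bv_op_delta //; apply: coboundaryN.
by exists (bv_op sigma X) => //; apply: multider_bv_op.
Qed.

(* The Schouten bracket extended bilinearly to inhomogeneous arguments. *)
Definition full_schouten P Q : seq S -> S :=
  circ P Q + circ (size_restrict (predC odd) Q) (grade P) - circ (size_restrict odd Q) P.

(** The failure of Delta to be a graded derivation, made of operations that visibly respect cocycles
    and coboundaries. *)
Definition bv_defect P Q : seq S -> S :=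
  bv_op sigma (wedge P Q) - wedge (bv_op sigma P) Q - wedge (grade P) (bv_op sigma Q).

(** The tool for descending the bracket to cohomology. The sign -(-1)^((m-1)n) is (-1)^m for odd n,
    absorbed by [grade P], and -1 for even n; hence the splitting of [Q] by parity. *)
Lemma full_schoutenE P Q : multider P -> multider Q ->
  full_schouten P Q
  = bv_defect (grade P) (size_restrict odd Q) - bv_defect P (size_restrict (predC odd) Q).
Proof.
move=> mP mQ; have [_ linP _ skP] := (multiderP _).1 mP.
have mgP := multider_grade mP; have [_ lingP _ skgP] := (multiderP _).1 mgP.
have mQo := multider_restrict odd mQ; have mQe := multider_restrict (predC odd) mQ.
have paro : parity true (size_restrict odd Q).
  by move=> s; rewrite /size_restrict; case: odd.
have pare : parity false (size_restrict (predC odd) Q).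
  by move=> s; rewrite /size_restrict /=; case: odd.
rewrite /bv_defect !bv_op_wedge // (circ_lastE linP pare) (circ_lastE lingP paro) gradeK.
have -> : full_schouten P Q = circ P (size_restrict odd Q) + circ P (size_restrict (predC odd) Q)
   + circ (size_restrict (predC odd) Q) (grade P) - circ (size_restrict odd Q) P.
  rewrite -circDr // (_ : size_restrict odd Q + size_restrict (predC odd) Q = Q) //.
  by apply/funext => s; rewrite addcE /size_restrict /=; case: odd; rewrite ?addr0 ?add0r.
by apply/funext => s; rewrite !(addcE, oppcE); ring.
Qed.

Lemma multiderB P Q : multider P -> multider Q -> multider (P - Q).
Proof. by move=> mP mQ; rewrite addrC -scaleN1r; apply: multider_comb. Qed.

Lemma cocycleB P Q : poisson_cocycle P -> poisson_cocycle Q -> poisson_cocycle (P - Q).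
Proof. by move=> cP cQ; rewrite addrC -scaleN1r; apply: cocycle_comb. Qed.

Lemma coboundaryB P Q :
  poisson_coboundary P -> poisson_coboundary Q -> poisson_coboundary (P - Q).
Proof. by move=> cP cQ; rewrite addrC -scaleN1r; apply: coboundary_comb. Qed.

Lemma multider_full_schouten P Q :
  multider P -> multider Q -> multider (full_schouten P Q).
Proof.
have mB P' Q' : multider P' -> multider Q' -> multider (bv_defect P' Q').
  move=> mP' mQ'; rewrite /bv_defect; apply: multiderB; last first.
    by apply: multider_wedge; [apply: multider_grade | apply: multider_bv_op].
  by apply: multiderB; [apply: multider_bv_op; apply: multider_wedge
    | apply: multider_wedge => //; apply: multider_bv_op].
move=> mP mQ; rewrite full_schoutenE //.
by apply: multiderB; apply: mB => //; [exact: multider_grade | exact: multider_restrict ..].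
Qed.

Lemma cocycle_full_schouten P Q :
  poisson_cocycle P -> poisson_cocycle Q -> poisson_cocycle (full_schouten P Q).
Proof.
have mB P' Q' : poisson_cocycle P' -> poisson_cocycle Q' -> poisson_cocycle (bv_defect P' Q').
  move=> mP' mQ'; rewrite /bv_defect; apply: cocycleB; last first.
    by apply: cocycle_wedge; [apply: cocycle_grade | apply: cocycle_bv_op].
  by apply: cocycleB; [apply: cocycle_bv_op; apply: cocycle_wedge
    | apply: cocycle_wedge => //; apply: cocycle_bv_op].
move=> cP cQ; rewrite full_schoutenE; [|by case: cP | by case: cQ].
by apply: cocycleB; apply: mB => //; [exact: cocycle_grade | exact: cocycle_restrict ..].
Qed.

Lemma coboundary_full_schoutenl P Q :
  poisson_cocycle P -> poisson_coboundary P -> poisson_cocycle Q ->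
  poisson_coboundary (full_schouten P Q).
Proof.
have mB P' Q' : poisson_coboundary P' -> poisson_cocycle Q' ->
    poisson_coboundary (bv_defect P' Q').
  move=> mP' mQ'; rewrite /bv_defect; apply: coboundaryB; last first.
    by apply: coboundary_wedgel; [apply: coboundary_grade | apply: cocycle_bv_op].
  by apply: coboundaryB; [apply: coboundary_bv_op; apply: coboundary_wedgel
    | apply: coboundary_wedgel => //; apply: coboundary_bv_op].
move=> cP bP cQ; rewrite full_schoutenE; [|by case: cP | by case: cQ].
by apply: coboundaryB; apply: mB => //; [exact: coboundary_grade | exact: cocycle_restrict ..].
Qed.

Lemma coboundary_full_schoutenr P Q :
  poisson_cocycle P -> poisson_cocycle Q -> poisson_coboundary Q ->
  poisson_coboundary (full_schouten P Q).
Proof.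
have mB P' Q' : poisson_cocycle P' -> poisson_coboundary Q' ->
    poisson_coboundary (bv_defect P' Q').
  move=> mP' mQ'; rewrite /bv_defect; apply: coboundaryB; last first.
    by apply: coboundary_wedger; [apply: cocycle_grade | apply: coboundary_bv_op].
  by apply: coboundaryB; [apply: coboundary_bv_op; apply: coboundary_wedger
    | apply: coboundary_wedger => //; apply: cocycle_bv_op].
move=> cP cQ bQ; rewrite full_schoutenE; [|by case: cP | by case: cQ].
by apply: coboundaryB; apply: mB => //; [exact: cocycle_grade | exact: coboundary_restrict ..].
Qed.

Lemma full_schouten_linearl (x : k) P P' Q : multider Q ->
  full_schouten (x *: P + P') Q = x *: full_schouten P Q + full_schouten P' Q.
Proof.
move=> mQ; have mr p := multider_restrict p mQ.
have lr p : multilinear (size_restrict p Q) by have [] := (multiderP _).1 (mr p).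
rewrite /full_schouten gradeD gradeZ !circ_linear // circDl circZl.
by rewrite !scalerDr scalerN opprD [RHS]addrACA [X in _ = X + _]addrACA.
Qed.

Lemma full_schouten_linearr (x : k) P Q Q' : multider P ->
  full_schouten P (x *: Q + Q') = x *: full_schouten P Q + full_schouten P Q'.
Proof.
move=> mP; have [_ linP _ _] := (multiderP _).1 mP.
rewrite /full_schouten !restrict_linear !circDl !circZl circ_linear //.
by rewrite !scalerDr scalerN opprD [RHS]addrACA [X in _ = X + _]addrACA.
Qed.

Lemma restrict_parity (p : pred nat) b P : parity b P ->
  (forall n, p n = (odd n == b)) -> size_restrict p P = P.
Proof.
move=> parP pE; apply/funext => s; rewrite /size_restrict pE.
by case: eqP => // /eqP/parP ->.
Qed.

Lemma restrict_parity0 (p : pred nat) b P : parity b P ->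
  (forall n, p n = (odd n != b)) -> size_restrict p P = 0.
Proof.
move=> parP pE; apply/funext => s; rewrite /size_restrict pE.
by case: eqP => // /eqP/parP ->.
Qed.

Lemma full_schouten_parity b c P Q : multider P -> multider Q -> parity b P -> parity c Q ->
  full_schouten P Q = pschouten b c P Q.
Proof.
move=> /multiderP[_ linP _ skP] /multiderP[_ linQ _ skQ] parP parQ.
rewrite /full_schouten /pschouten psignZ (grade_parity parP); case: c parQ => parQ.
  rewrite (@restrict_parity odd _ _ parQ) => [|n]; last by case: odd.
  rewrite (@restrict_parity0 (predC odd) _ _ parQ) => [|n]; last by rewrite /=; case: odd.
  by rewrite circ0l addr0 andbF.
rewrite (@restrict_parity (predC odd) _ _ parQ) => [|n]; last by rewrite /=; case: odd.
rewrite (@restrict_parity0 odd _ _ parQ) => [|n]; last by case: odd.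
by rewrite circ0l subr0 andbT; case: b {parP}; rewrite /= ?opprK ?circNr.
Qed.

Lemma bv_defect_parity b c P Q : multider P -> multider Q -> parity b P -> parity c Q ->
  bv_defect P Q = - (psign k (~~ b && c) *: pschouten b c P Q).
Proof.
move=> mP mQ parP parQ; have [_ linP _ skP] := (multiderP _).1 mP.
have [_ linQ _ skQ] := (multiderP _).1 mQ.
rewrite /bv_defect bv_op_wedge // (circ_lastE linP parQ) /pschouten !psignZ.
rewrite (grade_parity parP); case: b c {parP parQ} => -[] /=;
  rewrite ?(circNr, circNl) //; by apply/funext => s; rewrite !(addcE, oppcE); ring.
Qed.

End Cocycles.

(** * Classes in Poisson cohomology *)
Section IntegerDegrees.
Variables (k : fieldType) (S : comAlgType k).
Implicit Types (P Q R : seq S -> S) (s : seq S) (m n : int).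

Definition oddz m : bool := odd `|m|%N.

Lemma oddzD m n : oddz (m + n) = oddz m (+) oddz n.
Proof. rewrite /oddz; lia. Qed.

Lemma oddzM m n : oddz (m * n) = oddz m && oddz n.
Proof. by rewrite /oddz abszM oddM. Qed.

Lemma oddzB m n : oddz (m - n) = oddz m (+) oddz n.
Proof. by rewrite oddzD /oddz abszN. Qed.

Lemma oddz_pred m : oddz (m - 1) = ~~ oddz m.
Proof. by rewrite oddzB addbT. Qed.

Lemma exprz_sign m : (-1 : k) ^ m = psign k (oddz m).
Proof.
rewrite /psign /oddz; case: m => n; first by rewrite signr_odd.
by rewrite NegzE -exprnN abszN signr_odd -signr_odd invr_sign.
Qed.

Lemma parity_deg m P : multider_deg m P -> parity (oddz m) P.
Proof. by move=> [_ degP] s ne; apply: degP; apply: contra ne => /eqP <-. Qed.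

Lemma schoutenE m n P Q : schouten m n P Q = pschouten (oddz m) (oddz n) P Q.
Proof. by rewrite /schouten /pschouten exprz_sign oddzM !oddz_pred. Qed.

Lemma deg_wedge m n P Q :
  multider_deg m P -> multider_deg n Q -> multider_deg (m + n) (wedge P Q).
Proof.
move=> [mP degP] [mQ degQ]; split=> [|s ne]; first exact: multider_wedge.
rewrite wedgeE shuffle_sum0 // => A B szAB.
have [szA|/degP ->] := eqVneq (size A)%:Z m; last by rewrite mul0r.
by rewrite degQ ?mulr0 //; lia.
Qed.

Lemma deg_circ m n P Q s : multider_deg m P -> multider_deg n Q ->
  (size s)%:Z != m + n - 1 -> circ P Q s = 0.
Proof.
move=> [mP degP] [mQ degQ] ne; rewrite circE shuffle_sum0 // => A B szAB.
have [szA|/degQ ->] := eqVneq (size A)%:Z n.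
  by rewrite degP //=; lia.
have [_ linP _ _] := (multiderP _).1 mP.
exact: (@multilinear0 _ _ _ [::]).
Qed.

Lemma full_schouten_deg m n P Q : multider_deg m P -> multider_deg n Q ->
  full_schouten P Q = pschouten (oddz m) (oddz n) P Q.
Proof.
move=> degP degQ; have [[mP _] [mQ _]] := (degP, degQ).
exact: full_schouten_parity mP mQ (parity_deg degP) (parity_deg degQ).
Qed.

Lemma deg_full_schouten (sigma : frobeniusIso S) m n P Q :
  multider_deg m P -> multider_deg n Q ->
  multider_deg (m + n - 1) (full_schouten P Q).
Proof.
move=> degP degQ; have [[mP _] [mQ _]] := (degP, degQ); split=> [|s ne].
  exact: (multider_full_schouten sigma).
rewrite (full_schouten_deg degP degQ).
rewrite /pschouten psignZ; case: (_ && _);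
  by rewrite !(addcE, oppcE) !(deg_circ degP degQ, deg_circ degQ degP) ?oppr0 ?addr0 // (addrC n).
Qed.

Lemma deg_bv_op (sigma : frobeniusIso S) m P :
  multider_deg m P -> multider_deg (m - 1) (bv_op sigma P).
Proof.
move=> [mP degP]; split=> [|s ne]; first exact: multider_bv_op.
apply: bv_op_unique => // a; rewrite mul0r degP //=; lia.
Qed.

Lemma deg_restrict m P : multider P ->
  multider_deg m (size_restrict (fun i : nat => i%:Z == m) P).
Proof.
move=> mP; split=> [|s /negPf ne]; first exact: multider_restrict.
by rewrite /size_restrict ne.
Qed.

End IntegerDegrees.

(** * Cohomology classes and their representatives *)

Section CohomologyClasses.
Variables (k : fieldType) (S : comAlgType k) (br : poissonBracket S).
Implicit Types (P Q R : seq S -> S) (x y z : HP br) (m n : int).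

(** A relation with raw cochains keeps every identity at cochain level, away from the subtype of
    cocycles. *)
Definition represents P x : Prop :=
  exists2 R : cocycle br, cocycle_val R = P & x = HP_class R.

Lemma cocycleP (R : cocycle br) : poisson_cocycle br R.
Proof. exact: (asboolP _ (cocycle_valP R)). Qed.

Lemma represents_class (R : cocycle br) : represents R (HP_class R).
Proof. by exists R. Qed.

Lemma represents_cocycle P x : represents P x -> poisson_cocycle br P.
Proof. by move=> [R <- _]; apply: cocycleP. Qed.

Lemma represents_multider P x : represents P x -> multider P.
Proof. by move=> /represents_cocycle[]. Qed.

Lemma cocycle_represents P : poisson_cocycle br P -> exists x, represents P x.
Proof.
by move=> cP; exists (HP_class (Cocycle (asboolT cP))); exists (Cocycle (asboolT cP)).
Qed.

Lemma represents_surj x : exists P, represents P x.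
Proof. by have [R <-] := HP_class_surj x; exists R; apply: represents_class. Qed.

Lemma represents_eqP P Q x y : represents P x -> represents Q y ->
  x = y <-> poisson_coboundary br (P - Q).
Proof.
move=> [R <- ->] [T <- ->]; rewrite HP_classP.
have valB : val (R - T) = cocycle_val R - cocycle_val T by apply: (raddfB val).
by split=> [/asboolP[X mX]|[X mX eX]]; [|apply/asboolP]; exists X => //; rewrite -?eX -?valB.
Qed.

Lemma represents_inj P x y : represents P x -> represents P y -> x = y.
Proof.
move=> rx ry; apply/(represents_eqP rx ry); rewrite subrr.
by exists 0; [apply: multider0 | rewrite delta0].
Qed.

Lemma represents_eq P Q x y :
  represents P x -> represents Q y -> P = Q -> x = y.
Proof. by move=> rP rQ eqPQ; rewrite eqPQ in rP; apply: represents_inj rP rQ. Qed.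

Lemma represents_comb (a : k) P Q x y :
  represents P x -> represents Q y -> represents (a *: P + Q) (a *: x + y).
Proof.
move=> [R <- ->] [T <- ->]; exists (a *: R + T); first exact: (linearP val).
by rewrite HP_classD -HP_scaleE.
Qed.

Lemma represents0 : represents 0 0.
Proof.
have [P rP] := represents_surj 0; have := represents_comb (-1) rP rP.
by rewrite !scaleN1r !addNr.
Qed.

Lemma representsZ (a : k) P x : represents P x -> represents (a *: P) (a *: x).
Proof. by move=> rP; have := represents_comb a rP represents0; rewrite !addr0. Qed.

Lemma representsD P Q x y :
  represents P x -> represents Q y -> represents (P + Q) (x + y).
Proof. by move=> rP rQ; have := represents_comb 1 rP rQ; rewrite !scale1r. Qed.

Lemma representsN P x : represents P x -> represents (- P) (- x).
Proof. by rewrite -!scaleN1r; apply: representsZ. Qed.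

Lemma represents_sum (r : seq int) (P : int -> seq S -> S) (x : int -> HP br) :
  (forall m, represents (P m) (x m)) ->
  represents (\sum_(m <- r) P m) (\sum_(m <- r) x m).
Proof.
move=> rP; apply: (big_ind2 represents) => //; first exact: represents0.
by move=> *; apply: representsD.
Qed.

Lemma HP_degP m x :
  HP_deg m x <-> exists2 P, multider_deg m P & represents P x.
Proof.
split=> [[R degR ->]|[P degP [R eR ->]]].
  by exists R => //; apply: represents_class.
by exists R; rewrite ?eR.
Qed.

Lemma HP_graded_space : graded_space (@HP_deg k S br).
Proof.
split=> [m|m a x y|x|r f uniq_r gr_f sum0].
- apply/HP_degP; exists 0; last exact: represents0.
  by split; first exact: multider0.
- move=> /HP_degP[P [mP degP] rP] /HP_degP[Q [mQ degQ] rQ]; apply/HP_degP.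
  exists (a *: P + Q); last exact: represents_comb.
  split=> [|s ne]; first exact: multider_comb.
  by rewrite addcE scalecE degP // degQ // scaler0 addr0.
- have [P rP] := represents_surj x; have cP := represents_cocycle rP.
  have [mP _] := cP; have [[N bdP] _ _ _] := mP.
  pose Pm (m : int) := size_restrict (fun i : nat => i%:Z == m) P.
  have /choice[f rf] m : exists y, represents (Pm m) y.
    by apply: cocycle_represents; apply: cocycle_restrict.
  (* The bound [N] on the degrees occurring in [P] makes the decomposition finite. *)
  exists (map Posz (iota 0 N.+1)), f; split=> [m|].
    by apply/HP_degP; exists (Pm m) => //; apply: deg_restrict.
  apply: represents_inj rP _; have := represents_sum (map Posz (iota 0 N.+1)) rf.
  congr (represents _ _); apply/funext => s; rewrite fct_sumE big_map.
  case: (leqP (size s) N) => [le_sN|/[dup] lt_Ns /bdP Ps0]; last first.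
    by rewrite Ps0 big1 // => n _; rewrite /Pm /size_restrict Ps0 if_same.
  rewrite (bigD1_seq (size s)) ?iota_uniq ?mem_iota ?add0n ?ltnS //.
  rewrite /Pm /size_restrict eqxx big1 /= ?addr0 // => n nes.
  by rewrite eqz_nat eq_sym (negPf nes).
have /choice[P rP] m : exists P, multider_deg m P /\ represents P (f m).
  by have /HP_degP[P] := gr_f m; exists P.
have rsum := represents_sum r (fun m => (rP m).2); rewrite sum0 in rsum.
have := (represents_eqP rsum represents0).1 erefl; rewrite subr0 => bsum m rm.
apply/(represents_eqP (rP m).2 represents0); rewrite subr0.
(* The sum of the representatives is a coboundary; [delta] being homogeneous, so is its component of
   degree [m], which is [P m]. *)
rewrite (_ : P m = size_restrict (fun i : nat => i%:Z == m) (\sum_(j <- r) P j)).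
  exact: coboundary_restrict.
apply/funext => s; rewrite /size_restrict fct_sumE; have [_ degm] := (rP m).1.
have [szs|/degm //] := eqVneq (size s)%:Z m.
rewrite (bigD1_seq m) //= big1 ?addr0 // => j nej.
by have [_ ->] := (rP j).1; rewrite // szs eq_sym.
Qed.

Lemma lift_operator (Op : (seq S -> S) -> seq S -> S) :
  (forall (a : k) P Q, multider P -> multider Q -> Op (a *: P + Q) = a *: Op P + Op Q) ->
  (forall P, poisson_cocycle br P -> poisson_cocycle br (Op P)) ->
  (forall P, poisson_cocycle br P -> poisson_coboundary br P ->
     poisson_coboundary br (Op P)) ->
  exists2 f : HP br -> HP br, linear f & forall P x, represents P x -> represents (Op P) (f x).
Proof.
move=> linOp cOp bOp; have /choice[r rr] := represents_surj.
have /choice[f rf] x : exists y, represents (Op (r x)) y.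
  by apply: cocycle_represents; apply/cOp/(represents_cocycle (rr x)).
have Opf P x : represents P x -> represents (Op P) (f x).
  move=> rP; have cP := represents_cocycle rP; have [mP _] := cP.
  have [y ry] := cocycle_represents (cOp _ cP); rewrite (_ : f x = y) //.
  have [cr [mr _]] := (represents_cocycle (rr x), represents_cocycle (rr x)).
  apply/(represents_eqP (rf x) ry); rewrite addrC -scaleN1r -linOp //.
  apply: bOp; first exact: cocycle_comb.
  by rewrite scaleN1r addrC; apply/(represents_eqP (rr x) rP).
exists f => // a x y; apply: represents_inj (Opf _ _ (represents_comb a (rr x) (rr y))) _.
have [mx my] := (represents_multider (rr x), represents_multider (rr y)).
by rewrite linOp //; apply: represents_comb; apply: Opf.
Qed.

(** With a representative of the first class fixed, [lift_operator] treats the second variable;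
    changing that representative is then harmless. Each linearity hypothesis supposes the other
    argument to be a multiderivation, because [circ] is linear in the inserted cochain only when the
    outer one is multilinear. *)
Lemma lift_operator2 (Op : (seq S -> S) -> (seq S -> S) -> seq S -> S) :
  (forall (a : k) P P' Q, multider Q ->
     Op (a *: P + P') Q = a *: Op P Q + Op P' Q) ->
  (forall (a : k) P Q Q', multider P ->
     Op P (a *: Q + Q') = a *: Op P Q + Op P Q') ->
  (forall P Q, poisson_cocycle br P -> poisson_cocycle br Q ->
     poisson_cocycle br (Op P Q)) ->
  (forall P Q, poisson_cocycle br P -> poisson_coboundary br P ->
     poisson_cocycle br Q -> poisson_coboundary br (Op P Q)) ->
  (forall P Q, poisson_cocycle br P -> poisson_cocycle br Q ->
     poisson_coboundary br Q -> poisson_coboundary br (Op P Q)) ->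
  exists2 f : HP br -> HP br -> HP br, bilinear_op f &
    forall P Q x y, represents P x -> represents Q y -> represents (Op P Q) (f x y).
Proof.
move=> linl linr cOp bl brr; have /choice[r rr] := represents_surj.
have fixl x : exists2 f : HP br -> HP br, linear f &
    forall Q y, represents Q y -> represents (Op (r x) Q) (f y).
  have cx := represents_cocycle (rr x); have [mx _] := cx.
  by apply: lift_operator => *; [apply: linr | apply: cOp | apply: brr].
have /choice[f rf] x : exists f : HP br -> HP br, linear f /\
    forall Q y, represents Q y -> represents (Op (r x) Q) (f y).
  by have [f] := fixl x; exists f.
have Opf P Q x y : represents P x -> represents Q y -> represents (Op P Q) (f x y).
  move=> rP rQ; have [cP cQ] := (represents_cocycle rP, represents_cocycle rQ).
  have [y' ry] := cocycle_represents (cOp _ _ cP cQ); rewrite (_ : f x y = y') //.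
  have cr := represents_cocycle (rr x); have [mQ _] := cQ.
  apply/(represents_eqP ((rf x).2 _ _ rQ) ry); rewrite addrC -scaleN1r -linl //.
  apply: bl => //; first exact: cocycle_comb.
  by rewrite scaleN1r addrC; apply/(represents_eqP (rr x) rP).
exists f => //; split=> [z a x y|x]; last exact: (rf x).1.
apply: represents_inj (Opf _ _ _ _ (represents_comb a (rr x) (rr y)) (rr z)) _.
have mz := represents_multider (rr z).
by rewrite linl //; apply: represents_comb; apply: Opf.
Qed.

End CohomologyClasses.

Theorem theorem4p10 (k : fieldType) (S : comAlgType k)
  (br : poissonBracket S) (sigma : frobeniusIso S)
  (Hunimodular : unimodular br sigma) :
  exists (cup lie : HP br -> HP br -> HP br) (D : HP br -> HP br),
    [/\ HP_induced2 (@wedge k S) cup /\ HP_induced_schouten lie,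
        HP_induced1 (bv_op sigma) D,
        forall x, D (D x) = 0,
        forall (m n : int) (x y : HP br), HP_deg m x -> HP_deg n y ->
          lie x y
          = - ((-1 : k) ^ ((m - 1) * n)
               *: (D (cup x y) - cup (D x) y - (-1 : k) ^ m *: cup x (D y)))
      & bv_algebra (@HP_deg k S br) cup (HP_one br) D].
Proof.
have [D linD rD] : exists2 D : HP br -> HP br, linear D &
    forall P x, represents P x -> represents (bv_op sigma P) (D x).
  apply: lift_operator => [a P Q|P|P _]; first exact: bv_op_linear.
    exact: cocycle_bv_op.
  exact: coboundary_bv_op.
have [cup bil_cup rcup] : exists2 cup : HP br -> HP br -> HP br, bilinear_op cup &
    forall P Q x y, represents P x -> represents Q y ->
      represents (wedge P Q) (cup x y).
  apply: lift_operator2 => [a P P' Q _|a P Q Q' _|P Q|P Q _|P Q + _].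
  - by rewrite wedgeDl wedgeZl.
  - by rewrite wedgeDr wedgeZr.
  - exact: cocycle_wedge.
  - exact: coboundary_wedgel.
  - exact: coboundary_wedger.
have [lie bil_lie rlie] : exists2 lie : HP br -> HP br -> HP br, bilinear_op lie &
    forall P Q x y, represents P x -> represents Q y ->
      represents (full_schouten P Q) (lie x y).
  apply: lift_operator2.
  - by move=> a P P' Q; apply: full_schouten_linearl.
  - by move=> a P Q Q'; apply: full_schouten_linearr.
  - exact: (cocycle_full_schouten Hunimodular).
  - exact: (coboundary_full_schoutenl Hunimodular).
  - exact: (coboundary_full_schoutenr Hunimodular).
have DD x : D (D x) = 0.
  have [P rP] := represents_surj x.
  apply: (represents_eq (rD _ _ (rD _ _ rP)) (represents0 br)).
  by apply: bv_op_square; apply: represents_multider rP.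
have rone : represents (cochain1 S) (HP_one br).
  exact: (represents_class (Cocycle (cochain1_cocycle br))).
(* This removes the term with Delta(1) from the general Batalin-Vilkovisky bracket, which thereby
   becomes the stated formula. *)
have D1 : D (HP_one br) = 0.
  exact: (represents_eq (rD _ _ rone) (represents0 br) (bv_op_one sigma)).
have bvE m n x y : HP_deg m x -> HP_deg n y ->
    - ((-1 : k) ^ ((m - 1) * n) *: lie x y)
    = D (cup x y) - cup (D x) y - (-1 : k) ^ m *: cup x (D y).
  move=> /HP_degP[P degP rP] /HP_degP[Q degQ rQ].
  have [[mP _] [mQ _]] := (degP, degQ).
  have [parP parQ] := (parity_deg degP, parity_deg degQ).
  apply: (represents_eq (representsN (representsZ _ (rlie _ _ _ _ rP rQ)))
    (representsD (representsD (rD _ _ (rcup _ _ _ _ rP rQ))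
      (representsN (rcup _ _ _ _ (rD _ _ rP) rQ)))
      (representsN (representsZ _ (rcup _ _ _ _ rP (rD _ _ rQ)))))).
  rewrite !exprz_sign oddzM oddz_pred (full_schouten_deg degP degQ).
  rewrite -(bv_defect_parity sigma mP mQ parP parQ) /bv_defect (grade_parity parP).
  by rewrite psignZ; case: (oddz m); rewrite ?wedgeNl.
have degcup m n x y : HP_deg m x -> HP_deg n y -> HP_deg (m + n) (cup x y).
  move=> /HP_degP[P degP rP] /HP_degP[Q degQ rQ]; apply/HP_degP.
  by exists (wedge P Q); [apply: deg_wedge | apply: rcup].
have deglie m n x y : HP_deg m x -> HP_deg n y -> HP_deg (m + n - 1) (lie x y).
  move=> /HP_degP[P degP rP] /HP_degP[Q degQ rQ]; apply/HP_degP.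
  by exists (full_schouten P Q); [apply: (deg_full_schouten sigma) | apply: rlie].
have gca : graded_commutative_algebra (@HP_deg k S br) cup (HP_one br).
  split=> //.
  - by split=> //; apply: HP_graded_space.
  - move=> x y z; have [[P rP] [Q rQ]] := (represents_surj x, represents_surj y).
    have [R rR] := represents_surj z.
    apply: (represents_eq _ _ (wedgeA P Q R)); first by apply/rcup/rcup.
    by apply/rcup => //; apply: rcup.
  - split.
      apply/HP_degP; exists (cochain1 S) => //.
      by split; [apply: multider_one | case].
    move=> x; have [P rP] := represents_surj x; split.
      by apply: (represents_eq _ _ (wedge1l P)) => //; apply: rcup.
    by apply: (represents_eq _ _ (wedge1 P)) => //; apply: rcup.
  - move=> m n x y /HP_degP[P degP rP] /HP_degP[Q degQ rQ].
    apply: (represents_eq (rcup _ _ _ _ rP rQ) (representsZ _ (rcup _ _ _ _ rQ rP))).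
    by rewrite exprz_sign oddzM (wedgeC (parity_deg degP) (parity_deg degQ)).
exists cup, lie, D; split=> //.
- split=> [P Q|].
    by have [R eR ex] := rcup _ _ _ _ (represents_class P) (represents_class Q); exists R.
  split=> // m n P Q degP degQ.
  rewrite schoutenE -(full_schouten_deg degP degQ).
  by have [R eR eL] := rlie _ _ _ _ (represents_class P) (represents_class Q); exists R.
- by move=> P; have [R eR eD] := rD _ _ (represents_class P); exists R.
- move=> m n x y degx degy; rewrite -(bvE _ _ _ _ degx degy) scalerN opprK scalerA.
  by rewrite exprz_sign /psign -signr_addb addbb scale1r.
split=> //.
- move=> m x /HP_degP[P degP rP]; apply/HP_degP.
  by exists (bv_op sigma P); [apply: deg_bv_op | apply: rD].
exists lie; split.
  move=> m n x y degx degy; rewrite (bvE _ _ _ _ degx degy) D1.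
  have cup0 z : cup z 0 = 0.
    by have := bil_cup.2 z (-1) 0 0; rewrite scaler0 addr0 scaleN1r addNr.
  have cup0l z : cup 0 z = 0.
    by have := bil_cup.1 z (-1) 0 0; rewrite scaler0 addr0 scaleN1r addNr.
  by rewrite cup0 cup0l scaler0 addr0.
split=> //.
- move=> m n x y /HP_degP[P degP rP] /HP_degP[Q degQ rQ].
  apply: (represents_eq (rlie _ _ _ _ rP rQ)
    (representsN (representsZ _ (rlie _ _ _ _ rQ rP)))).
  rewrite exprz_sign oddzM !oddz_pred (full_schouten_deg degP degQ).
  by rewrite (full_schouten_deg degQ degP) -pschouten_anti.
- move=> m n p x y z /HP_degP[P degP rP] /HP_degP[Q degQ rQ] /HP_degP[R degR rR].
  have [[mP _] [mQ _] [mR _]] := And3 degP degQ degR.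
  have [parP parQ parR] := And3 (parity_deg degP) (parity_deg degQ) (parity_deg degR).
  apply: (represents_eq (rlie _ _ _ _ rP (rlie _ _ _ _ rQ rR))
    (representsD (rlie _ _ _ _ (rlie _ _ _ _ rP rQ) rR)
      (representsZ _ (rlie _ _ _ _ rQ (rlie _ _ _ _ rP rR))))).
  rewrite exprz_sign oddzM !oddz_pred.
  rewrite (full_schouten_deg degP (deg_full_schouten sigma degQ degR)).
  rewrite (full_schouten_deg (deg_full_schouten sigma degP degQ) degR).
  rewrite (full_schouten_deg degQ (deg_full_schouten sigma degP degR)).
  rewrite (full_schouten_deg degP degQ) (full_schouten_deg degP degR).
  rewrite (full_schouten_deg degQ degR).
  by rewrite !oddz_pred !oddzD; apply: pschouten_jacobi.
move=> m n p x y z /HP_degP[P degP rP] /HP_degP[Q degQ rQ] /HP_degP[R degR rR].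
have [[mP _] [mQ _] [mR _]] := And3 degP degQ degR.
have [parP parQ parR] := And3 (parity_deg degP) (parity_deg degQ) (parity_deg degR).
apply: (represents_eq (rlie _ _ _ _ (rcup _ _ _ _ rP rQ) rR)
  (representsD (rcup _ _ _ _ (rlie _ _ _ _ rP rR) rQ)
    (representsZ _ (rcup _ _ _ _ rP (rlie _ _ _ _ rQ rR))))).
rewrite exprz_sign oddzM oddz_pred (full_schouten_deg degP degR).
rewrite (full_schouten_deg degQ degR).
rewrite (full_schouten_deg (deg_wedge degP degQ) degR) oddzD.
exact: pschouten_leibniz.
Qed.
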